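(* Let $m\ge 1$, $1\le p<\infty$, and let $U\subset F_B(\mathbb{R}^m)$. Then $U$ is compact in $(F_B(\mathbb{R}^m), d_p)$ if and only if $U$ is closed in $(F_B(\mathbb{R}^m), d_p)$ and (i) $U$ is uniformly $p$-mean bounded; (ii) $U$ is $p$-mean equi-left-continuous; and (iii$'$) for every sequence $\{u_n: n=1,2,\ldots\}\subset U$ there exist $r>0$ and a subsequence $\{v_n\}$ of $\{u_n\}$ such that $\lim_{n\to\infty}|v_n|^r=0$, where $|\cdot|^r$ is the functional defined in the context (the $r$ is a superscript index, not a power).
   Context: $H$ is the Hausdorff metric on nonempty closed subsets of $\mathbb{R}^m$ (Euclidean distance): $H(A,B)=\max\{\sup_{a\in A}\inf_{b\in B}d(a,b),\ \sup_{b\in B}\inf_{a\in A}d(a,b)\}$. A fuzzy set on $\mathbb{R}^m$ is a function $u:\mathbb{R}^m\to[0,1]$; its cuts are $[u]_\alpha=\{x: u(x)\ge\alpha\}$ for $\alpha\in(0,1]$ and $[u]_0=\overline{\{x: u(x)>0\}}$. $F_B(\mathbb{R}^m)$ is the set of fuzzy sets $u$ on $\mathbb{R}^m$ that are normal ($u(x_0)=1$ for some $x_0$), upper semi-continuous, and have $[u]_0$ bounded. The metric is $d_p(u,v)=\left(\int_0^1 H([u]_\alpha,[v]_\alpha)^p\,d\alpha\right)^{1/p}$. A set $U$ of such fuzzy sets is uniformly $p$-mean bounded if there is $M>0$ with $d_p(u,\widehat{0})\le M$ for all $u\in U$, where $\widehat 0$ is the characteristic function of $\{0\}$ ($0$ the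 origin). $U$ is $p$-mean equi-left-continuous if for every $\varepsilon>0$ there is $\delta>0$ such that for all $0\le h<\delta$ and all $u\in U$, $\left(\int_h^1 H([u]_\alpha,[u]_{\alpha-h})^p\,d\alpha\right)^{1/p}<\varepsilon$. For $r>0$ let $B_r=\{x\in\mathbb{R}^m:\|x\|\le r\}$, let $\widehat{B_r}$ be its characteristic function, and for $u\in F_B(\mathbb{R}^m)$ put $|u|^r:=\left(\int_0^1 H([u\vee\widehat{B_r}]_\alpha,[\widehat{B_r}]_\alpha)^p\,d\alpha\right)^{1/p}$, where $\vee$ is the pointwise maximum. *)

(* Defs.v *)
(* R^m is 'rV[R]_m over an arbitrary R : realType. *)
From HB Require Import structures.
From mathcomp Require Import all_boot all_order all_algebra.
From mathcomp Require Import all_classical all_reals all_analysis.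

Set Implicit Arguments.
Unset Strict Implicit.
Unset Printing Implicit Defensive.

Import Order.TTheory GRing.Theory Num.Theory.
Import numFieldNormedType.Exports.

Local Open Scope classical_set_scope.
Local Open Scope ring_scope.

(* The library's norm on 'rV[R]_m is the sup norm, so the Euclidean one is
   introduced here; both induce the library's (product) topology. *)
Definition enorm (R : realType) (m : nat) (x : 'rV[R]_m) : R :=
  Num.sqrt (\sum_(i < m) x ord0 i ^+ 2).

Definition eball (R : realType) (m : nat) (r : R) : set 'rV[R]_m :=
  [set x | enorm x <= r].

Definition hausdorff (R : realType) (m : nat) (A B : set 'rV[R]_m) : \bar R :=
  maxe
    (ereal_sup [set ereal_inf [set (enorm (a - b))%:E | b in B] | a in A])
    (ereal_sup [set ereal_inf [set (enorm (a - b))%:E | a in A] | b in B]).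

Definition fuzzy_set (R : realType) (m : nat) (u : 'rV[R]_m -> R) : Prop :=
  forall x, 0 <= u x <= 1.

(* Only meaningful for alpha in [0, 1]. *)
Definition fuzzy_cut (R : realType) (m : nat) (u : 'rV[R]_m -> R) (alpha : R) :
    set 'rV[R]_m :=
  if alpha == 0 then closure [set x | 0 < u x] else [set x | alpha <= u x].

Definition fuzzy_normal (R : realType) (m : nat) (u : 'rV[R]_m -> R) : Prop :=
  exists x0, u x0 = 1.

Definition upper_semicontinuous (R : realType) (m : nat)
    (u : 'rV[R]_m -> R) : Prop :=
  forall (x : 'rV[R]_m) (a : R), u x < a -> \forall y \near x, u y < a.

Definition ebounded (R : realType) (m : nat) (A : set 'rV[R]_m) : Prop :=
  exists M : R, forall x, A x -> enorm x <= M.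

Record FB (R : realType) (m : nat) := MkFB {
  FB_fun :> 'rV[R]_m -> R;
  FB_fuzzy : fuzzy_set FB_fun;
  FB_normal : fuzzy_normal FB_fun;
  FB_usc : upper_semicontinuous FB_fun;
  FB_bounded : ebounded (fuzzy_cut FB_fun 0)
}.

Definition dp (R : realType) (m : nat) (p : R) (u v : 'rV[R]_m -> R) :
    \bar R :=
  ((\int[lebesgue_measure]_(alpha in `[0%R, 1%R])
      (hausdorff (fuzzy_cut u alpha) (fuzzy_cut v alpha) `^ p)) `^ p^-1)%E.

(* The space (F_B(R^m), d_p): the parameter p selects the topology. *)
Definition FBdp (R : realType) (m : nat) (p : R) : Type := FB R m.

HB.instance Definition _ (R : realType) (m : nat) (p : R) :=
  gen_eqMixin (@FBdp R m p).
HB.instance Definition _ (R : realType) (m : nat) (p : R) :=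
  gen_choiceMixin (@FBdp R m p).

Section dp_topology.
Variables (R : realType) (m : nat) (p : R).

Definition dp_open (A : set (@FBdp R m p)) : Prop :=
  forall u : FBdp m p, A u ->
    exists2 e : R, 0 < e & forall v : FBdp m p, (dp p u v < e%:E)%E -> A v.

Lemma dp_openT : dp_open setT.
Proof. by move=> u _; exists 1. Qed.

Lemma dp_openI (A B : set (@FBdp R m p)) :
  dp_open A -> dp_open B -> dp_open (A `&` B).
Proof.
move=> oA oB u [/oA[e e0 eA] /oB[d d0 dB]].
exists (Num.min e d); first by rewrite lt_min e0 d0.
by move=> v; rewrite EFin_min lt_min => /andP[/eA ? /dB].
Qed.

Lemma dp_open_bigU (I : Type) (F : I -> set (@FBdp R m p)) :
  (forall i, dp_open (F i)) -> dp_open (\bigcup_i F i).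
Proof.
by move=> oF u [i _ /oF[e e0 eF]]; exists e => // v /eF Fv; exists i.
Qed.

HB.instance Definition _ := isOpenTopological.Build (@FBdp R m p)
  dp_openT dp_openI dp_open_bigU.

End dp_topology.

Definition uniformly_p_mean_bounded (R : realType) (m : nat) (p : R)
    (U : set (@FBdp R m p)) : Prop :=
  exists2 M : R, 0 < M &
    forall u : FBdp m p, U u -> (dp p u \1_[set 0%R] <= M%:E)%E.

Definition p_mean_equi_left_continuous (R : realType) (m : nat) (p : R)
    (U : set (@FBdp R m p)) : Prop :=
  forall eps : R, 0 < eps -> exists2 delta : R, 0 < delta &
    forall h : R, 0 <= h < delta -> forall u : FBdp m p, U u ->
    ((\int[lebesgue_measure]_(alpha in `[h, 1%R])
        (hausdorff (fuzzy_cut u alpha) (fuzzy_cut u (alpha - h)%R) `^ p)) `^ p^-1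
     < eps%:E)%E.

Definition fuzzy_max (R : realType) (m : nat) (u v : 'rV[R]_m -> R) :
    'rV[R]_m -> R :=
  fun x => Num.max (u x) (v x).

(* |u|^r *)
Definition excess (R : realType) (m : nat) (p r : R) (u : 'rV[R]_m -> R) :
    \bar R :=
  dp p (fuzzy_max u \1_(@eball R m r)) \1_(@eball R m r).

(* Main.v *)
(* Suppose (iii') holds and |v_n|^r -> 0. Pass to a subsequence along which the
   suprema of v_n over each set of a countable base of R^m converge, and let
   u(x) be the infimum of the limits over the basic neighbourhoods of x. Then u
   is upper semi-continuous, normal and supported in B_r, and
   H([v_n]_a, [u]_a) -> 0 unless a is the supremum of u over some basic set,
   which excludes only countably many a. As
   H([v_n]_a, [u]_a) <= E_n(a) + min(H([v_n]_a, [u]_a), 2r),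
   where E_n is the integrand of |v_n|^r, bounded convergence gives
   d_p(v_n, u) -> 0. Conversely, (i), (ii) and (iii') are all tested on
   convergent subsequences; (ii) for a single fuzzy set follows by dominated
   convergence from the left continuity of its cuts, and (iii') holds with a
   ball containing the support of the limit. *)
Require Import Defs.
From HB Require Import structures.
From mathcomp Require Import all_boot all_order all_algebra.
From mathcomp Require Import all_classical all_reals all_analysis.
From mathcomp Require Import measurable_realfun ring lra.

Set Implicit Arguments.
Unset Strict Implicit.
Unset Printing Implicit Defensive.

Import Order.TTheory GRing.Theory Num.Theory.
Import numFieldNormedType.Exports.

Local Open Scope classical_set_scope.
Local Open Scope ring_scope.

(** * The Euclidean norm *)

(** The obstacle is that near level 0 the cuts of the [v_n] may spread arbitrarily far while the
    integrals stay small, so that no constant dominates the distances to the limit. The excess E_n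
    over the ball repairs this in two ways. Pointwise: E_n is nonincreasing in the level, so a small
    integral makes it small at each fixed positive level; every such cut eventually lies in the ball
    of radius r + 1, and compactness arguments apply there. In the mean: the cuts of [v_n] and of
    the limit lie in the balls of radii r + E_n and r, hence H <= 2r + E_n, which is where the
    truncation at 2r comes from. Two points of rigour shape the rest. The integrals need measurable
    integrands: level 0, whose cut is a closure, is a null set, and at positive levels upper
    semi-continuity makes the sets where the distance exceeds a constant open to the left. Also,
    compactness is stated with filters in a topology given by its open sets, so its sequential form
    has to be proved. *)

Section euclidean_norm.
Context {R : realType} {m : nat}.
Implicit Types (x y z : 'rV[R]_m) (A : set 'rV[R]_m).

Lemma enorm_ge0 x : 0 <= enorm x.
Proof. exact: sqrtr_ge0. Qed.

Lemma sumsq_ge0 x : 0 <= \sum_(i < m) x ord0 i ^+ 2.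
Proof. by apply: sumr_ge0 => i _; exact: sqr_ge0. Qed.

Lemma sqr_enorm x : enorm x ^+ 2 = \sum_(i < m) x ord0 i ^+ 2.
Proof. by rewrite sqr_sqrtr// sumsq_ge0. Qed.

Lemma enormN x : enorm (- x) = enorm x.
Proof. by congr Num.sqrt; apply: eq_bigr => i _; rewrite mxE sqrrN. Qed.

Lemma enormB x y : enorm (x - y) = enorm (y - x).
Proof. by rewrite -enormN opprB. Qed.

Lemma enorm_coord x i : `|x ord0 i| <= enorm x.
Proof.
rewrite -sqrtr_sqr ler_sqrt ?sumsq_ge0// (bigD1 i)//= lerDl.
by apply: sumr_ge0 => j _; exact: sqr_ge0.
Qed.

Lemma enorm0 : enorm (0 : 'rV[R]_m) = 0.
Proof. by rewrite /enorm big1 ?sqrtr0// => i _; rewrite mxE expr0n. Qed.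

Lemma enorm_eq0 x : enorm x = 0 -> x = 0.
Proof.
move=> x0; apply/rowP => i; rewrite mxE; apply/eqP.
by rewrite -normr_le0 -x0 enorm_coord.
Qed.

(** Expanding the sum of the squares of |y| x_i - |x| y_i gives 2 |x| |y| (|x| |y| - <x, y>), which
    is nonnegative; divide by the positive factor. *)
Lemma cauchy_schwarz x y :
  \sum_(i < m) x ord0 i * y ord0 i <= enorm x * enorm y.
Proof.
have [/eqP/enorm_eq0->|x0] := boolP (enorm x == 0).
  by rewrite enorm0 mul0r big1// => i _; rewrite mxE mul0r.
have [/eqP/enorm_eq0->|y0] := boolP (enorm y == 0).
  by rewrite enorm0 mulr0 big1// => i _; rewrite mxE mulr0.
have xy0 : 0 < enorm x * enorm y by rewrite mulr_gt0// lt0r ?x0 ?y0 enorm_ge0.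
have : 0 <= \sum_(i < m) (enorm y * x ord0 i - enorm x * y ord0 i) ^+ 2.
  by apply: sumr_ge0 => i _; exact: sqr_ge0.
have sqE i : (enorm y * x ord0 i - enorm x * y ord0 i) ^+ 2 =
    enorm y ^+ 2 * x ord0 i ^+ 2 + enorm x ^+ 2 * y ord0 i ^+ 2
    - 2 * (enorm x * enorm y) * (x ord0 i * y ord0 i) by ring.
under eq_bigr do rewrite sqE.
rewrite sumrB big_split/= -!mulr_sumr -!sqr_enorm => h.
rewrite -(ler_pM2l xy0) -subr_ge0 -(@pmulr_rge0 _ 2)//.
by apply: le_trans h _; rewrite le_eqVlt; apply/orP; left; apply/eqP; ring.
Qed.

Lemma enormD x y : enorm (x + y) <= enorm x + enorm y.
Proof.
rewrite -(@ler_pXn2r _ 2)// ?nnegrE ?addr_ge0 ?enorm_ge0//.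
rewrite sqr_enorm sqrrD !sqr_enorm.
under eq_bigr do rewrite mxE sqrrD -mulr_natl.
rewrite !big_split/= -mulr_sumr lerD2r lerD2l -(mulr_natl (_ * _)) ler_wpM2l//.
exact: cauchy_schwarz.
Qed.

Lemma enorm_triangle z x y : enorm (x - y) <= enorm (x - z) + enorm (z - y).
Proof. by rewrite (le_trans _ (enormD _ _))// addrA subrK. Qed.

Lemma mx_norm_le_enorm x : `|x| <= enorm x.
Proof.
rewrite [leLHS]/Num.norm/= mx_normrE; apply/bigmax_leP => /=.
by split; [exact: enorm_ge0|move=> [i j] _ /=; rewrite ord1 enorm_coord].
Qed.

Lemma coord_le_mx_norm x i : `|x ord0 i| <= `|x|.
Proof.
by rewrite [leRHS]/Num.norm /= mx_normrE; apply/bigmax_geP; right; exists (ord0, i).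
Qed.

(** The crude factor m, instead of its square root, is enough to compare the two norms: m e^2 <= (m
    e)^2. *)
Lemma enorm_le_bound x e : 0 <= e -> (forall i, `|x ord0 i| <= e) ->
  enorm x <= m%:R * e.
Proof.
move=> e0 xe; rewrite -(@ler_pXn2r _ 2)// ?nnegrE ?mulr_ge0 ?enorm_ge0//.
rewrite sqr_enorm (@le_trans _ _ (\sum_(i < m) e ^+ 2))//.
  by apply: ler_sum => i _; rewrite -real_normK ?num_real// lerXn2r ?nnegrE.
rewrite sumr_const card_ord -[leLHS]mulr_natl exprMn ler_wpM2r ?sqr_ge0//.
by rewrite -natrX ler_nat; case: (m) => // k; rewrite leq_pmull.
Qed.

Lemma nbhs_enorm x e : 0 < e -> \forall y \near x, enorm (x - y) < e.
Proof.
(* The denominator m + 1 is never 0 and makes m e / (m + 1) < e strict. *)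
move=> e0; have d0 : 0 < e / (m%:R + 1) by rewrite divr_gt0.
apply: filterS (nbhsx_ballx _ _ d0) => y; rewrite mx_norm_ball /ball_/= => xy.
rewrite (@le_lt_trans _ _ (m%:R * (e / (m%:R + 1))))//.
  apply: enorm_le_bound; first exact: ltW.
  by move=> i; rewrite (le_trans (coord_le_mx_norm _ _))// ltW.
by rewrite mulrCA gtr_pMr// ltr_pdivrMr// mul1r ltrDl.
Qed.

Lemma enorm_nbhs x A : nbhs x A ->
  exists2 e, 0 < e & forall y, enorm (x - y) < e -> A y.
Proof.
move=> /nbhs_ballP[e /= e0 eA]; exists e => // y xy; apply: eA.
by rewrite mx_norm_ball /ball_/= (le_lt_trans (mx_norm_le_enorm _)).
Qed.

Lemma ebounded_closed_compact A : ebounded A -> closed A -> compact A.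
Proof.
move=> [M AM] cA; apply: bounded_closed_compact cA.
exists M; split; first exact: num_real.
move=> N MN x /AM xM; apply: le_trans (mx_norm_le_enorm _) _.
exact: le_trans xM (ltW MN).
Qed.

Lemma closed_enorm_le x e : closed [set y | enorm (x - y) <= e].
Proof.
rewrite -openC openE => y /= /negP; rewrite -ltNge => ey.
have d0 : 0 < enorm (x - y) - e by rewrite subr_gt0.
apply: filterS (nbhs_enorm y d0) => z yz; apply/negP; rewrite -ltNge.
by have := enorm_triangle z x y; rewrite (enormB z); lra.
Qed.

Lemma closed_enorm_ge A e : closed [set y | forall x, A x -> e <= enorm (x - y)].
Proof.
rewrite -openC openE => y /= /existsNP[x /not_implyP[Ax /negP]]; rewrite -ltNge => ey.
have d0 : 0 < e - enorm (x - y) by rewrite subr_gt0.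
apply: filterS (nbhs_enorm y d0) => z yz h.
by have := h _ Ax; have := enorm_triangle y x z; lra.
Qed.

(** The base consists of the balls with rational centre and radius 1/(k+1), numbered by [pickle];
    numbers that code nothing give the empty set. *)
Lemma countable_base : exists B : nat -> set 'rV[R]_m,
  forall x A, nbhs x A -> exists2 i, nbhs x (B i) & B i `<=` A.
Proof.
exists (fun i => if @unpickle ('rV[rat]_m * nat)%type i is Some (c, k) then
  [set y | enorm (map_mx ratr c - y) < k.+1%:R^-1] else set0).
move=> x A /enorm_nbhs[e e0 eA].
have e20 : 0 < e / 2 by rewrite divr_gt0.
have [k ke] : exists k, k.+1%:R^-1 < e / 2.
  exists (Num.trunc (e / 2)^-1); rewrite invf_plt ?posrE//.
  exact: truncnS_gt.
have d0 : 0 < (k.+1%:R^-1 : R) / (m%:R + 1) by rewrite divr_gt0.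
have /choice[q qx] : forall i, exists q : rat,
    `|ratr q - x ord0 i| <= (k.+1%:R^-1 : R) / (m%:R + 1).
  move=> i; have : x ord0 i < x ord0 i + (k.+1%:R^-1 : R) / (m%:R + 1).
    by rewrite ltrDl.
  move=> /rat_in_itvoo[q]; rewrite in_itv/= => /andP[xq qx]; exists q.
  by rewrite ger0_norm ?subr_ge0 1?ltW// ltrBlDl.
exists (pickle (\row_i q i, k)); rewrite pickleK; last first.
  move=> y /= cy; apply: eA; have := enorm_triangle (map_mx ratr (\row_i q i)) x y.
  suff : enorm (x - map_mx ratr (\row_i q i)) < k.+1%:R^-1.
    by move: ke cy; set w := _^-1; lra.
  rewrite (@le_lt_trans _ _ (m%:R * (k.+1%:R^-1 / (m%:R + 1))))//.
    apply: enorm_le_bound; first exact: ltW.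
    by move=> i; rewrite !mxE distrC.
  by rewrite mulrCA gtr_pMr// ltr_pdivrMr// mul1r ltrDl.
have cx : enorm (map_mx ratr (\row_i q i) - x) < k.+1%:R^-1.
  rewrite (@le_lt_trans _ _ (m%:R * (k.+1%:R^-1 / (m%:R + 1))))//.
    apply: enorm_le_bound; first exact: ltW.
    by move=> i; rewrite !mxE.
  by rewrite mulrCA gtr_pMr// ltr_pdivrMr// mul1r ltrDl.
move: cx; rewrite -subr_gt0 => cx.
apply: filterS (nbhs_enorm x cx) => y /= xy.
move: xy (enorm_triangle x (map_mx ratr (\row_i q i)) y).
by set w := _^-1; lra.
Qed.

End euclidean_norm.

(** * Hausdorff distance and level sets *)

(** Agrees with [fuzzy_cut] at positive levels and avoids the closure at level 0, which the
    integrals do not see. *)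
Definition level {R : realType} {m : nat} (u : 'rV[R]_m -> R) (a : R) :
  set 'rV[R]_m := [set x | a <= u x].

(** One half of the Hausdorff distance without suprema and infima: distance < e gives both
    inclusions, and both inclusions give distance <= e. *)
Definition in_fattening {R : realType} {m : nat} (e : R) (A B : set 'rV[R]_m) :=
  forall a, A a -> exists2 b, B b & enorm (a - b) < e.

Definition nonempty_bounded {R : realType} {m : nat} (A : set 'rV[R]_m) :=
  A !=set0 /\ ebounded A.

(* [fine] maps infinite distances to 0; this is meant for nonempty bounded
   sets, whose distance is finite. *)
Definition rhausdorff {R : realType} {m : nat} (A B : set 'rV[R]_m) : R :=
  fine (hausdorff A B).

Section hausdorff_distance.
Context {R : realType} {m : nat}.
Implicit Types (A B C : set 'rV[R]_m) (e : R).

Lemma in_fattening_trans A B C e f :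
  in_fattening e A B -> in_fattening f B C -> in_fattening (e + f) A C.
Proof.
move=> AB BC a /AB[b /BC[c Cc bc] ab]; exists c => //.
by have := enorm_triangle b a c; lra.
Qed.

Lemma sub_in_fattening A B e : 0 < e -> A `<=` B -> in_fattening e A B.
Proof. by move=> e0 AB a /AB Ba; exists a => //; rewrite subrr enorm0. Qed.

Lemma hausdorff_le A B e : in_fattening e A B -> in_fattening e B A ->
  (hausdorff A B <= e%:E)%E.
Proof.
move=> AB BA; rewrite ge_max; apply/andP; split; apply: ge_ereal_sup.
  move=> _ [a /AB[b Bb ab] <-]; apply: (@le_trans _ _ (enorm (a - b))%:E).
    by apply: ereal_inf_lbound; exists b.
  by rewrite lee_fin ltW.
move=> _ [b /BA[a Aa ab] <-]; apply: (@le_trans _ _ (enorm (a - b))%:E).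
  by apply: ereal_inf_lbound; exists a.
by rewrite lee_fin enormB ltW.
Qed.

Lemma hausdorff_lt A B e : (hausdorff A B < e%:E)%E ->
  in_fattening e A B /\ in_fattening e B A.
Proof.
rewrite gt_max => /andP[AB BA]; split.
  move=> a Aa; have : (ereal_inf [set (enorm (a - b))%:E | b in B] < e%:E)%E.
    by apply: le_lt_trans AB; apply: ereal_sup_ubound; exists a.
  by move=> /ereal_inf_lt[_ [b Bb <-]]; rewrite lte_fin; exists b.
move=> b Bb; have : (ereal_inf [set (enorm (a - b))%:E | a in A] < e%:E)%E.
  by apply: le_lt_trans BA; apply: ereal_sup_ubound; exists b.
by move=> /ereal_inf_lt[_ [a Aa <-]]; rewrite lte_fin enormB; exists a.
Qed.

Lemma hausdorff_ge0 A B : A !=set0 -> (0 <= hausdorff A B)%E.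
Proof.
move=> [a Aa]; rewrite le_max; apply/orP; left.
apply: (@le_trans _ _ (ereal_inf [set (enorm (a - b))%:E | b in B])).
  by apply: le_ereal_inf_tmp => _ [b _ <-]; rewrite lee_fin enorm_ge0.
by apply: ereal_sup_ubound; exists a.
Qed.

Lemma nonempty_bounded_in_fattening A B :
  nonempty_bounded A -> nonempty_bounded B -> exists e, in_fattening e A B.
Proof.
move=> [_ [M AM]] [[b Bb] _]; exists (M + enorm b + 1) => a /AM aM.
by exists b => //; have := enormD a (- b); rewrite enormN; lra.
Qed.

Lemma hausdorff_fin_num A B : nonempty_bounded A -> nonempty_bounded B ->
  hausdorff A B \is a fin_num.
Proof.
move=> nA nB; rewrite ge0_fin_numE ?hausdorff_ge0//; last by case: nA.
have [e AB] := nonempty_bounded_in_fattening nA nB.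
have [f BA] := nonempty_bounded_in_fattening nB nA.
apply: (@le_lt_trans _ _ (Num.max e f)%:E); last exact: ltry.
apply: hausdorff_le => [a /AB[b ? h]|a /BA[b ? h]]; exists b => //.
  by rewrite lt_max h.
by rewrite lt_max h orbT.
Qed.

Lemma rhausdorffE A B : nonempty_bounded A -> nonempty_bounded B ->
  hausdorff A B = (rhausdorff A B)%:E.
Proof. by move=> nA nB; rewrite fineK// hausdorff_fin_num. Qed.

Lemma rhausdorff_ge0 A B : A !=set0 -> 0 <= rhausdorff A B.
Proof. by move=> A0; apply: fine_ge0; exact: hausdorff_ge0. Qed.

Lemma rhausdorff_le A B e : nonempty_bounded A -> nonempty_bounded B ->
  in_fattening e A B -> in_fattening e B A -> rhausdorff A B <= e.
Proof.
by move=> nA nB AB BA; rewrite -lee_fin -rhausdorffE//; exact: hausdorff_le.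
Qed.

Lemma rhausdorff_lt A B e : nonempty_bounded A -> nonempty_bounded B ->
  rhausdorff A B < e -> in_fattening e A B /\ in_fattening e B A.
Proof.
by move=> nA nB; rewrite -lte_fin -rhausdorffE//; exact: hausdorff_lt.
Qed.

Lemma rhausdorff_sym A B : nonempty_bounded A -> nonempty_bounded B ->
  rhausdorff A B = rhausdorff B A.
Proof.
suff le : forall X Y : set 'rV[R]_m, nonempty_bounded X -> nonempty_bounded Y ->
    rhausdorff X Y <= rhausdorff Y X.
  by move=> nA nB; apply/eqP; rewrite eq_le !le.
move=> X Y nX nY; apply/ler_addgt0Pr => e e0.
by have [|YX XY] := @rhausdorff_lt Y X (rhausdorff Y X + e) nY nX;
  [rewrite ltrDl|exact: rhausdorff_le].
Qed.

Lemma rhausdorff_triangle B A C : nonempty_bounded A -> nonempty_bounded B ->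
  nonempty_bounded C -> rhausdorff A C <= rhausdorff A B + rhausdorff B C.
Proof.
move=> nA nB nC; apply/ler_addgt0Pr => e e0.
have e20 : 0 < e / 2 by rewrite divr_gt0.
have [|AB BA] := @rhausdorff_lt A B (rhausdorff A B + e / 2) nA nB.
  by rewrite ltrDl.
have [|BC CB] := @rhausdorff_lt B C (rhausdorff B C + e / 2) nB nC.
  by rewrite ltrDl.
have -> : rhausdorff A B + rhausdorff B C + e =
  (rhausdorff A B + e / 2) + (rhausdorff B C + e / 2) by lra.
apply: rhausdorff_le => //; first exact: in_fattening_trans AB BC.
by rewrite addrC; exact: in_fattening_trans CB BA.
Qed.

Lemma rhausdorff_eq0_sub A B : nonempty_bounded A -> nonempty_bounded B ->
  closed B -> rhausdorff A B = 0 -> A `<=` B.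
Proof.
move=> nA nB cB AB0 a Aa; apply: cB => N /enorm_nbhs[e e0 eN].
have [|AB _] := @rhausdorff_lt A B e nA nB; first by rewrite AB0.
by have [b Bb ab] := AB _ Aa; exists b; split=> //; exact: eN.
Qed.

End hausdorff_distance.

(** * Level sets of upper semi-continuous functions *)

Section levels.
Context {R : realType} {m : nat}.
Implicit Types (u v : FB R m) (K : set 'rV[R]_m).

Lemma fuzzy_cutE (u : 'rV[R]_m -> R) a : 0 < a -> fuzzy_cut u a = level u a.
Proof. by move=> a0; rewrite /fuzzy_cut gt_eqF. Qed.

Lemma FB_ge0 u x : 0 <= u x.
Proof. by case/andP: (FB_fuzzy u x). Qed.

Lemma FB_le1 u x : u x <= 1.
Proof. by case/andP: (FB_fuzzy u x). Qed.

Lemma level_le (u : 'rV[R]_m -> R) a b : a <= b -> level u b `<=` level u a.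
Proof. by move=> ab x; exact: le_trans. Qed.

Lemma level_bounded u :
  exists M, forall a x, 0 < a -> level u a x -> enorm x <= M.
Proof.
have [M uM] := FB_bounded u; exists M => a x a0 ux; apply: uM.
rewrite /fuzzy_cut eqxx; by apply: subset_closure => /=; exact: lt_le_trans ux.
Qed.

Lemma level_nonempty_bounded u a : 0 < a <= 1 -> nonempty_bounded (level u a).
Proof.
move=> /andP[a0 a1]; split.
  by have [x ux] := FB_normal u; exists x; rewrite /level/= ux.
by have [M uM] := level_bounded u; exists M => x; exact: uM.
Qed.

Lemma usc_level_closed (u : 'rV[R]_m -> R) a :
  upper_semicontinuous u -> closed (level u a).
Proof.
move=> usc; rewrite -openC openE => x /= /negP; rewrite -ltNge => /usc.
by apply: filterS => y uy; apply/negP; rewrite -ltNge.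
Qed.

Lemma level_compact u a : 0 < a -> compact (level u a).
Proof.
move=> a0; apply: ebounded_closed_compact; last first.
  exact: usc_level_closed (@FB_usc _ _ u).
by have [M uM] := level_bounded u; exists M => x; exact: uM.
Qed.

Lemma enorm_ball_compact (x : 'rV[R]_m) e : compact [set y | enorm (x - y) <= e].
Proof.
apply: ebounded_closed_compact (@closed_enorm_le _ _ _ _).
exists (enorm x + e) => y /= xy.
by have := enorm_triangle x y 0; rewrite !subr0 enormB; lra.
Qed.

(** A strict bound on a compact set leaves a gap. The near-covering form of compactness, applied to
    b tending to a from the left, also covers empty [K], where there is no maximum to take. *)
Lemma usc_compact_lt (u : 'rV[R]_m -> R) K a : upper_semicontinuous u ->
  compact K -> (forall x, K x -> u x < a) ->
  exists2 b, b < a & forall x, K x -> u x < b.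
Proof.
move=> usc /compact_near_coveringP cK Ka.
have : \forall b \near a^'-, K `<=` (fun x => u x < b).
  apply: cK => x /Ka uxa; pose c := (u x + a) / 2.
  have uc : u x < c by rewrite /c; lra.
  have ca : c < a by rewrite /c; lra.
  exists ([set y | u y < c], [set b | c < b]); last first.
    by move=> [y b] /= [uyc cb]; exact: lt_trans cb.
  by split; [exact: usc|exact: nbhs_left_gt].
move=> h; suff [b [ba bK]] : exists b, b < a /\ K `<=` (fun x => u x < b) by exists b.
by apply: (@filter_ex _ (a^'-)); apply: filterI => //; exact: nbhs_left_lt.
Qed.

Lemma level_left_continuous u a e : 0 < a <= 1 -> 0 < e ->
  exists2 d, 0 < d & forall g, 0 < g -> a - d < g <= a ->
    rhausdorff (level u a) (level u g) <= e.
Proof.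
move=> /andP[a0 a1] e0.
(* [K] holds the points that could spoil the estimate: far from the level at a, yet in a compact
   lower level. There u < a, hence u < b < a, so the levels above max(a/2, b) miss [K]. *)
pose K := level u (a / 2) `&` [set x | forall y, level u a y -> e <= enorm (y - x)].
have cK : compact K.
  apply: compact_closedI; last exact: closed_enorm_ge.
  by apply: level_compact; rewrite divr_gt0.
have [|b ba Kb] := @usc_compact_lt u K a (@FB_usc _ _ u) cK.
  move=> x [_ /= xK]; rewrite ltNge; apply/negP => /xK.
  by rewrite subrr enorm0 leNgt e0.
exists (Num.min (a / 2) (a - b)); first by rewrite lt_min divr_gt0//= subr_gt0.
move=> g g0 /andP[+ ga].
rewrite ltrBlDr -ltrBlDl lt_min => /andP[ag bg].
apply: rhausdorff_le.
- by apply: level_nonempty_bounded; rewrite a0.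
- by apply: level_nonempty_bounded; rewrite g0 (le_trans ga).
- by apply: sub_in_fattening => //; exact: level_le.
move=> x ux; apply: contrapT => /forall2NP h.
have : u x < b.
  apply: Kb; split; first by apply: level_le ux; lra.
  by move=> y /= uy; rewrite leNgt; apply/negP; have [//|] := h y; rewrite enormB.
by rewrite ltNge => /negP; apply; move: ux; rewrite /level/= => ?; lra.
Qed.

End levels.

(** * Measurability of the distance between levels *)

Section measurability.
Context {R : realType} {m : nat}.
Implicit Types (u v : FB R m).

(* Such a set is the union over the rationals q of the intervals made of the
   points x such that the segment joining q and x lies in the set. *)
Lemma left_open_measurable (S : set R) :
  (forall x, S x -> exists2 y, y < x & `]y, x] `<=` S) -> measurable S.
Proof.
move=> oS.
have -> : S = \bigcup_(q : rat) [set x | forall z : R,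
    Num.min (ratr q) x <= z <= Num.max (ratr q) x -> S z].
  apply/seteqP; split => [x Sx|x [q _]/=]; last first.
    by apply; rewrite ge_min le_max lexx !orbT.
  have [y yx yxS] := oS _ Sx.
  have [q] := rat_in_itvoo yx; rewrite in_itv/= => /andP[yq qx].
  exists q => // z; rewrite (min_l (ltW qx)) (max_r (ltW qx)) => /andP[qz zx].
  by apply: yxS; rewrite /= in_itv/= zx andbT (lt_le_trans yq).
apply: bigcupT_measurable_rat => q; apply: is_interval_measurable.
move=> x y /= hx hy z /andP[xz zy] w.
rewrite ge_min le_max => /andP[/orP[qw|zw] /orP[wq|wz]].
- by apply: hx; rewrite ge_min qw le_max wq.
- by apply: hy; rewrite ge_min qw le_max (le_trans wz zy) orbT.
- by apply: hx; rewrite ge_min (le_trans xz zw) orbT le_max wq.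
- have [qz|zq] := leP (ratr q) w.
    by apply: hy; rewrite ge_min qz le_max (le_trans wz zy) orbT.
  by apply: hx; rewrite ge_min (le_trans xz zw) orbT le_max (ltW zq).
Qed.

(** A point a of the first level at distance at least e from the second has v < x - t on the closed
    ball of radius e' about it, r < e' < e, and so v < b < x - t there. Lowering x to z > b + t
    keeps a in the first level and the second level off that ball. The bound by h keeps both levels
    positive. *)
Let left_open_level u v (s t h r : R) : 0 <= s <= h -> 0 <= t <= h ->
  forall x : R, h < x <= 1 -> forall e, r < e ->
  ~ in_fattening e (level u (x - s)) (level v (x - t)) ->
  exists2 y, h <= y < x & forall z, y < z <= x ->
    r < rhausdorff (level u (z - s)) (level v (z - t)).
Proof.
move=> /andP[s0 sh] /andP[t0 th] x /andP[hx x1] e re.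
move=> /existsNP[a /not_implyP[ua /forall2NP va]].
pose e' := (r + e) / 2.
have ree : r < e' < e by rewrite /e'; apply/andP; split; lra.
have [|b bx bv] := @usc_compact_lt _ _ v _ (x - t) (@FB_usc _ _ v)
    (@enorm_ball_compact _ _ a e').
  move=> y /= ay; rewrite ltNge; apply/negP => vy; have [//|] := va y; lra.
exists (Num.max h (b + t)).
  by rewrite le_max lexx/= gt_max hx -ltrBrDr.
move=> z; rewrite gt_max => /andP[/andP[hz bz] zx].
rewrite ltNge; apply/negP => hle.
have [|||/(_ a) []] := @rhausdorff_lt _ _ (level u (z - s)) (level v (z - t)) e'.
- apply: level_nonempty_bounded; apply/andP; split; lra.
- apply: level_nonempty_bounded; apply/andP; split; lra.
- lra.
- by apply: level_le ua; rewrite lerD2r.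
move=> y vy ay _; have := bv y; rewrite /= ltW// => /(_ isT).
by move: vy; rewrite /level/= => ? ?; lra.
Qed.

(** Two independent shifts serve the integrand of [dp] (no shift), that of equi-left-continuity (one
    shift) and translated distances (equal shifts). *)
Lemma measurable_rhausdorff_level u v (s t h : R) : 0 <= s <= h -> 0 <= t <= h ->
  measurable_fun `]h, 1]
    (fun a : R => rhausdorff (level u (a - s)) (level v (a - t))).
Proof.
move=> sh th mD; apply: (measurability _ (RGenOInfty.measurableE R)) => //.
move=> _ [_ [r ->] <-].
apply: left_open_measurable => x [/=]; rewrite !in_itv/= andbT => hx rx.
have nu : nonempty_bounded (level u (x - s)).
  by apply: level_nonempty_bounded; apply/andP; split; lra.
have nv : nonempty_bounded (level v (x - t)).
  by apply: level_nonempty_bounded; apply/andP; split; lra.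
pose e := (r + rhausdorff (level u (x - s)) (level v (x - t))) / 2.
have re : r < e by rewrite /e; lra.
have : ~ (in_fattening e (level u (x - s)) (level v (x - t)) /\
          in_fattening e (level v (x - t)) (level u (x - s))).
  by move=> [uv vu]; have := rhausdorff_le nu nv uv vu; rewrite /e; lra.
move=> /not_andP[uv|vu].
  have [y /andP[hy yx] yxr] := left_open_level sh th hx re uv.
  exists y => // z; rewrite /= !in_itv/= andbT => yzx; split; last exact: yxr.
  by apply/andP; split; lra.
have [y /andP[hy yx] yxr] := left_open_level th sh hx re vu.
exists y => // z; rewrite /= !in_itv/= andbT => yzx.
have hz : h < z <= 1 by apply/andP; split; lra.
split=> //; rewrite rhausdorff_sym; first exact: yxr.
  by apply: level_nonempty_bounded; apply/andP; split; lra.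
by apply: level_nonempty_bounded; apply/andP; split; lra.
Qed.

End measurability.

(** * L^p norms of real functions *)

Lemma cvge0P {R : realType} (x : nat -> \bar R) : (forall n, 0 <= x n)%E ->
  x n @[n --> \oo] --> 0%E <->
  forall e : R, 0 < e -> \forall n \near \oo, (x n < e%:E)%E.
Proof.
move=> x0; split.
  move=> /fine_cvgP[xfin /cvgr0Pnorm_lt xc] e e0.
  apply: filterS2 xfin (xc _ e0) => n xnfin.
  by rewrite ger0_norm ?fine_ge0// -lte_fin fineK.
move=> xc; apply/fine_cvgP; split.
  apply: filterS (xc _ ltr01) => n xn.
  by rewrite ge0_fin_numE// (lt_trans xn)// ltry.
apply/cvgr0Pnorm_lt => e e0; apply: filterS (xc _ e0) => n xn.
rewrite ger0_norm ?fine_ge0// -lte_fin fineK//.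
by rewrite ge0_fin_numE// (lt_trans xn)// ltry.
Qed.

Section Lp_norm.
Context {R : realType}.
Local Notation mu := (@lebesgue_measure R).
Implicit Types (f g : R -> R) (D : set R) (p : R).

(** Extending by 0 makes this a norm over the whole line, to which Minkowski's inequality applies
    directly. *)
Definition Lpnorm p D f : \bar R := 'N[mu]_p%:E [EFin \o (f \_ D)].

Lemma Lpnorm_ge0 p D f : (0 <= Lpnorm p D f)%E.
Proof. exact: Lnorm_ge0. Qed.

Lemma LpnormE p D f : 0 < p -> (forall x, D x -> 0 <= f x) ->
  Lpnorm p D f = ((\int[mu]_(x in D) (f x `^ p)%:E) `^ p^-1)%E.
Proof.
move=> p0 f0; rewrite /Lpnorm unlock [in RHS]integral_mkcond; congr (_ `^ _)%E.
apply: eq_integral => x _; rewrite /= /patch; case: ifPn => [|_] /=.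
  by rewrite inE => /f0 fx0; rewrite ger0_norm.
by rewrite normr0 powR0// gt_eqF.
Qed.

Lemma LpnormD p D f g : 1 <= p -> measurable D ->
  measurable_fun D f -> measurable_fun D g ->
  (Lpnorm p D (fun x => f x + g x)%R <= Lpnorm p D f + Lpnorm p D g)%E.
Proof.
move=> p1 mD mf mg; rewrite /Lpnorm.
rewrite (_ : (fun x => f x + g x) \_ D = (f \_ D \+ g \_ D)%R); last first.
  by apply/funext => x; rewrite /patch/=; case: ifPn => // _; rewrite addr0.
apply: minkowski_EFin => //; exact/(measurable_restrictT _ _).1.
Qed.

Lemma le_Lpnorm p D f g : 1 <= p -> measurable D ->
  measurable_fun D f -> measurable_fun D g ->
  (forall x, D x -> 0 <= f x <= g x) -> (Lpnorm p D f <= Lpnorm p D g)%E.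
Proof.
move=> p1 mD mf mg fg; have p0 : 0 < p by exact: lt_le_trans p1.
have f0 x : D x -> 0 <= f x by move=> /fg/andP[].
have g0 x : D x -> 0 <= g x by move=> /fg/andP[]; exact: le_trans.
rewrite !LpnormE//; apply: gt0_ler_poweR.
- by rewrite invr_ge0 ltW.
- by rewrite in_itv/= leey andbT; apply: integral_ge0 => x _; rewrite lee_fin powR_ge0.
- by rewrite in_itv/= leey andbT; apply: integral_ge0 => x _; rewrite lee_fin powR_ge0.
apply: ge0_le_integral => //.
- by move=> x _; rewrite lee_fin powR_ge0.
- by apply/measurable_EFinP; exact: (measurableT_comp (measurable_powR _)).
- by apply/measurable_EFinP; exact: (measurableT_comp (measurable_powR _)).
- move=> x Dx; have /andP[fx0 fgx] := fg _ Dx.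
  by rewrite lee_fin; apply: ge0_ler_powR; rewrite ?nnegrE ?f0 ?g0// ltW.
Qed.

Lemma Lpnorm_subset p D E f : 1 <= p -> measurable D -> measurable E ->
  measurable_fun E f -> (forall x, E x -> 0 <= f x) -> D `<=` E ->
  (Lpnorm p D f <= Lpnorm p E f)%E.
Proof.
move=> p1 mD mE mf f0 DE; have p0 : 0 < p by exact: lt_le_trans p1.
rewrite !LpnormE//; last by move=> x /DE; exact: f0.
apply: gt0_ler_poweR.
- by rewrite invr_ge0 ltW.
- by rewrite in_itv/= leey andbT; apply: integral_ge0 => x _; rewrite lee_fin powR_ge0.
- by rewrite in_itv/= leey andbT; apply: integral_ge0 => x _; rewrite lee_fin powR_ge0.
apply: ge0_subset_integral => //.
- by apply/measurable_EFinP; exact: (measurableT_comp (measurable_powR _)).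
- by move=> x _; rewrite lee_fin powR_ge0.
Qed.

Lemma Lpnorm_shift p (h : R) f : 1 <= p -> 0 <= h -> measurable_fun `](0 : R), 1] f ->
  (forall x : R, 0 < x <= 1 -> 0 <= f x) ->
  (Lpnorm p `]h, 1%R] (fun x => f (x - h))%R <= Lpnorm p `]0%R, 1%R] f)%E.
Proof.
move=> p1 h0 mf f0; have p0 : 0 < p by exact: lt_le_trans p1.
have sub : `]0, 1 - h] `<=` `](0 : R), 1].
  by move=> x /=; rewrite !in_itv/= => /andP[->]/=; lra.
apply: (@le_trans _ _ (Lpnorm p `]0, 1 - h] f)); last exact: Lpnorm_subset.
rewrite !LpnormE//; last 2 first.
- by move=> x /sub; exact: f0.
- by move=> x; rewrite /= in_itv/= => ?; apply: f0; lra.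
pose phi : measurableTypeR R -> measurableTypeR R := fun x => x - h.
have mphi : measurable_fun setT phi by exact: measurable_funB.
have -> : `]h, 1]%classic = phi @^-1` `]0, 1 - h].
  by apply/seteqP; split=> x; rewrite /phi /= !in_itv/= subr_gt0 lerD2r.
have <- := @ge0_integral_pushforward _ _ _ _ R phi mphi mu `]0, 1 - h]
  (fun x => (f x `^ p)%:E).
- rewrite le_eqVlt; apply/orP; left; apply/eqP; congr (_ `^ _)%E.
  (* Translation invariance: the image of Lebesgue measure under [phi] gives half-open intervals
     their length, so it is Lebesgue measure. *)
  apply: eq_measure_integral => A mA _; apply/esym.
  apply: lebesgue_measure_unique => // _ [[a b] _ <-].
  rewrite /= /pushforward.
  have -> : phi @^-1` `]a, b] = `]a + h, b + h]%classic.
    by apply/seteqP; split=> x; rewrite /phi /= !in_itv/= ltrBrDr lerBlDr.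
  rewrite !lebesgue_measure_itv/= !lte_fin ltrD2r.
  by case: ifPn => // _; rewrite -!EFinB; congr (_%:E); lra.
- exact: measurable_itv.
- apply/measurable_EFinP; apply: (measurableT_comp (measurable_powR _)).
  exact: measurable_funS mf.
- by move=> x _; rewrite lee_fin powR_ge0.
Qed.

(** Dominated convergence for the p-th powers, with a constant as dominating function and the
    countable, hence null, set [C] of exceptions. *)
Lemma Lpnorm_bounded_cvg0 p (M : R) (C : set R) (f : nat -> R -> R) : 1 <= p ->
  countable C ->
  (forall n, measurable_fun `](0 : R), 1] (f n)) ->
  (forall n (x : R), 0 < x <= 1 -> 0 <= f n x <= M) ->
  (forall x : R, 0 < x <= 1 -> ~ C x -> f n x @[n --> \oo] --> 0) ->
  Lpnorm p `]0, 1] (f n) @[n --> \oo] --> 0%E.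
Proof.
move=> p1 cC mf f0M fC; have p0 : 0 < p by exact: lt_le_trans p1.
have f0 n x : `]0, 1]%classic x -> 0 <= f n x.
  by rewrite /= in_itv/= => /(f0M n)/andP[].
have pn : p != 0 by rewrite gt_eqF.
apply/cvge0P => [n|e e0]; first exact: Lpnorm_ge0.
have [|//||||_ _] := @dominated_convergence _ _ _ mu `]0%R, 1%R]
  (measurable_itv _) (fun n x => (f n x `^ p)%:E) (cst 0%E) (cst (M `^ p)%:E).
- move=> n; apply/measurable_EFinP.
  exact: (measurableT_comp (measurable_powR _) (mf n)).
- exists C; split => [||x /=].
  + exact: countable_measurable.
  + exact: countable_lebesgue_measure0.
  + apply: contra_notP => nCx; rewrite in_itv/= => x01.
    apply/cvge0P => [n|d d0]; first by rewrite lee_fin powR_ge0.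
    have d0' : 0 < d `^ p^-1 by exact: powR_gt0.
    have /cvgr0Pnorm_lt /(_ _ d0') := fC _ x01 nCx.
    apply: filterS => n; rewrite lte_fin.
    have fn0 : 0 <= f n x by apply: f0; rewrite /= in_itv.
    rewrite ger0_norm// => fd; rewrite -[ltRHS](@powRr1 _ d) ?ltW//.
    rewrite -(mulVf pn) powRrM gt0_ltr_powR// nnegrE//; exact: powR_ge0.
- apply/integrableP; split; first exact: measurable_cst.
  under eq_integral do rewrite /=.
  rewrite integral_cst//.
  rewrite [X in (_ * X)%E](_ : _ = 1%E); last first.
    by have := @lebesgue_measure_itv R `]0%R, 1%R]; rewrite /= lte_fin ltr01 oppr0 adde0.
  by rewrite mule1 ltry.
- apply: aeW => x n; rewrite /= in_itv/= => /(f0M n)/andP[fn0 fM].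
  rewrite lee_fin ger0_norm ?powR_ge0//.
  apply: ge0_ler_powR; rewrite ?nnegrE//; first exact: ltW.
  exact: le_trans fM.
rewrite integral0 => /cvge0P h.
have e0' : 0 < e `^ p by exact: powR_gt0.
have int0 n : (0 <= \int[mu]_(x in `]0%R, 1%R]) (f n x `^ p)%:E)%E.
  by apply: integral_ge0 => x _; rewrite lee_fin powR_ge0.
have := h int0 _ e0'; apply: filterS => n.
rewrite LpnormE//; last exact: f0.
move: (int0 n); case: (integral _ _ _) => [r| |] // r0; rewrite !lte_fin => re.
rewrite -[ltRHS](@powRr1 _ e) ?ltW// -(mulfV pn) powRrM.
by rewrite gt0_ltr_powR ?invr_gt0// nnegrE// powR_ge0.
Qed.

End Lp_norm.

(** * The metric d_p *)

Section dp_metric.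
Context {R : realType} {m : nat} (p : R).
Hypothesis p1 : 1 <= p.
Local Notation mu := (@lebesgue_measure R).
Implicit Types (u v w : FB R m).

Let p0 : 0 < p. Proof. exact: lt_le_trans p1. Qed.

Definition level_dist u v (a : R) : R := rhausdorff (level u a) (level v a).

Lemma level_dist_ge0 u v a : 0 < a <= 1 -> 0 <= level_dist u v a.
Proof. by move=> a01; apply: rhausdorff_ge0; case: (level_nonempty_bounded u a01). Qed.

Lemma level_dist_sym u v a : 0 < a <= 1 -> level_dist u v a = level_dist v u a.
Proof. by move=> a01; apply: rhausdorff_sym; exact: level_nonempty_bounded. Qed.

Lemma level_dist_triangle v u w a : 0 < a <= 1 ->
  level_dist u w a <= level_dist u v a + level_dist v w a.
Proof. by move=> a01; apply: rhausdorff_triangle; exact: level_nonempty_bounded. Qed.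

Lemma rhausdorff_level_bounded u v : exists M, forall a b,
  0 < a <= 1 -> 0 < b <= 1 -> rhausdorff (level u a) (level v b) <= M.
Proof.
have [M uM] := level_bounded u; have [N vN] := level_bounded v.
exists (M + N + 1) => a b a01 b01.
have /andP[a0 _] := a01; have /andP[b0 _] := b01.
have nu := level_nonempty_bounded u a01.
have nv := level_nonempty_bounded v b01.
apply: rhausdorff_le => // x.
  move=> /(uM _ _ a0) xM; have [[y vy] _] := nv; exists y => //.
  have := vN _ _ b0 vy; have := enormD x (- y); rewrite enormN; lra.
move=> /(vN _ _ b0) xN; have [[y uy] _] := nu; exists y => //.
have := uM _ _ a0 uy; have := enormD x (- y); rewrite enormN; lra.
Qed.

Lemma measurable_level_dist u v : measurable_fun `](0 : R), 1] (level_dist u v).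
Proof.
have := @measurable_rhausdorff_level _ _ u v 0 0 0.
rewrite lexx => /(_ isT isT); rewrite [X in measurable_fun _ X -> _](_ : _ =
  level_dist u v)//.
by apply/funext => a; rewrite !subr0.
Qed.

(** Dropping the endpoint h, a null set, leaves only positive levels a and a - s. The case s = h = 0
    is [dp], the case s = h is equi-left-continuity. *)
Lemma cut_integralE u v (s h : R) : 0 <= s <= h ->
  ((\int[mu]_(a in `[h, 1%R])
     (hausdorff (fuzzy_cut u a) (fuzzy_cut v (a - s)%R) `^ p)) `^ p^-1)%E =
  Lpnorm p `]h, 1] (fun a => rhausdorff (level u a) (level v (a - s))).
Proof.
move=> /andP[s0 sh].
have h01 a : `]h, 1]%classic a -> 0 < a <= 1 /\ 0 < a - s <= 1.
  by rewrite /= in_itv/= => /andP[? ?]; split; apply/andP; split; lra.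
have E : {in `]h, 1]%classic, (fun a =>
    (rhausdorff (level u a) (level v (a - s)) `^ p)%:E) =1
    (fun a => hausdorff (fuzzy_cut u a) (fuzzy_cut v (a - s)%R) `^ p)%E}.
  move=> a; rewrite inE => /h01[a01 as01].
  have /andP[a0 _] := a01; have /andP[as0 _] := as01.
  by rewrite !fuzzy_cutE// rhausdorffE//; exact: level_nonempty_bounded.
rewrite -integral_itv_obnd_cbnd; last first.
  apply: (eq_measurable_fun _ E); apply/measurable_EFinP.
  apply: (measurableT_comp (measurable_powR _)).
  have := @measurable_rhausdorff_level _ _ u v 0 s h.
  rewrite lexx (le_trans s0 sh) s0 sh => /(_ isT isT).
  rewrite [X in measurable_fun _ X -> _](_ : _ =
    fun a => rhausdorff (level u a) (level v (a - s)))//.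
  by apply/funext => a; rewrite subr0.
rewrite LpnormE//; last first.
  move=> a /h01[a01 _]; apply: rhausdorff_ge0.
  by case: (level_nonempty_bounded u a01).
by congr (_ `^ _)%E; apply: eq_integral => a /E.
Qed.

Lemma dpE u v : dp p u v = Lpnorm p `]0, 1] (level_dist u v).
Proof.
have := @cut_integralE u v 0 0; rewrite lexx => /(_ isT).
under eq_integral do rewrite subr0.
rewrite -[LHS]/(dp p u v) => ->; congr Lpnorm.
by apply/funext => a; rewrite subr0.
Qed.

Lemma dp_ge0 u v : (0 <= dp p u v)%E.
Proof. by rewrite dpE Lpnorm_ge0. Qed.

Lemma le_dp (u v u' v' : FB R m) :
  (forall a, 0 < a <= 1 -> level_dist u v a <= level_dist u' v' a) ->
  (dp p u v <= dp p u' v')%E.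
Proof.
move=> le; rewrite !dpE; apply: le_Lpnorm => //; try exact: measurable_level_dist.
by move=> a; rewrite /= in_itv/= => a01; rewrite level_dist_ge0//= le.
Qed.

Lemma dp_sym u v : dp p u v = dp p v u.
Proof.
by apply/eqP; rewrite eq_le; apply/andP; split; apply: le_dp => a a01;
  rewrite level_dist_sym.
Qed.

Lemma dp_triangle v u w : (dp p u w <= dp p u v + dp p v w)%E.
Proof.
rewrite !dpE; apply: le_trans (LpnormD p1 _ _ _) => //;
  try exact: measurable_level_dist.
apply: le_Lpnorm => //; first exact: measurable_level_dist.
  by apply: measurable_funD; exact: measurable_level_dist.
move=> a; rewrite /= in_itv/= => a01.
by rewrite level_dist_ge0// level_dist_triangle.
Qed.

Lemma dp_lty u v : (dp p u v < +oo)%E.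
Proof.
have [M uvM'] := rhausdorff_level_bounded u v.
have uvM a : 0 < a <= 1 -> level_dist u v a <= M by move=> a01; exact: uvM'.
have M0 : 0 <= M.
  have h1 : 0 < (1 : R) <= 1 by rewrite ltr01 lexx.
  exact: le_trans (level_dist_ge0 u v h1) (uvM _ h1).
apply: (@le_lt_trans _ _ (Lpnorm p `]0, 1] (cst M))).
  rewrite dpE; apply: le_Lpnorm => //; first exact: measurable_level_dist.
  move=> a; rewrite /= in_itv/= => a01.
  by rewrite level_dist_ge0// uvM.
rewrite LpnormE//; apply: poweR_lty.
under eq_integral do rewrite /=.
rewrite integral_cst//.
rewrite [X in (_ * X)%E](_ : _ = 1%E); last first.
  by have := @lebesgue_measure_itv R `]0%R, 1%R]; rewrite /= lte_fin ltr01 oppr0 adde0.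
by rewrite mule1 ltry.
Qed.

(** If v x < u x, then x separates the levels at every a in ]v x, u x], so the distance is nonzero
    on an interval of positive measure. *)
Lemma dp_eq0_le u v : dp p u v = 0%E -> forall x, u x <= v x.
Proof.
rewrite dpE => uv0 x; rewrite leNgt; apply/negP => vu.
have : (EFin \o (level_dist u v \_ `]0, 1])) = cst 0%E %[ae mu].
  apply: (@Lnorm_eq0_eq0 _ _ _ _ _ p%:E) => //.
  apply/measurable_EFinP/(measurable_restrictT _ _).1 => //.
  exact: measurable_level_dist.
move=> [N [mN N0 subN]].
have : `](v x), (u x)] `<=` N.
  move=> a /=; rewrite in_itv/= => /andP[va au]; apply: subN => /= /(_ I).
  have a01 : 0 < a <= 1.
    by rewrite (le_lt_trans (FB_ge0 v x) va) (le_trans au (FB_le1 u x)).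
  rewrite patchE mem_set/=; last by rewrite in_itv/=.
  move=> [d0].
  have : level v a x.
    apply: (rhausdorff_eq0_sub _ _ _ d0) => //;
      try exact: level_nonempty_bounded.
    exact: usc_level_closed (@FB_usc _ _ v).
  by rewrite /level/= leNgt va.
have N0' : (mu N <= 0)%E by rewrite N0.
move=> /(le_measure mu (mem_set (measurable_itv _)) (mem_set mN)).
move=> /le_trans /(_ N0').
rewrite [X in (X <= _)%E](_ : _ = (u x - v x)%:E).
  by rewrite lee_fin leNgt subr_gt0 vu.
by have := @lebesgue_measure_itv R `](v x), (u x)]; rewrite /= lte_fin vu -EFinB.
Qed.

Lemma FB_eq u v : (forall x, u x = v x) -> u = v.
Proof.
case: u v => [u fu nu su bu] [v fv nv sv bv] /= /funext uv.
case: v / uv in fv nv sv bv *.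
by congr MkFB; exact: Prop_irrelevance.
Qed.

Lemma dp_eq0 u v : dp p u v = 0%E -> u = v.
Proof.
move=> uv0; apply: FB_eq => x; apply/eqP; rewrite eq_le dp_eq0_le//=.
by rewrite dp_eq0_le// dp_sym.
Qed.

Lemma dpxx u : dp p u u = 0%E.
Proof.
apply/eqP; rewrite eq_le dp_ge0 andbT dpE LpnormE//; last first.
  by move=> a; rewrite /= in_itv/=; exact: level_dist_ge0.
rewrite integral0_eq; first by rewrite poweR0r// invr_neq0// gt_eqF.
move=> a; rewrite /= in_itv/= => a01.
suff -> : level_dist u u a = 0 by rewrite powR0// gt_eqF.
apply/eqP; rewrite eq_le level_dist_ge0// andbT; apply/ler_addgt0Pr => e e0.
by rewrite add0r; apply: rhausdorff_le;
  [exact: level_nonempty_bounded..|exact: sub_in_fattening|exact: sub_in_fattening].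
Qed.

End dp_metric.

(** * Balls and the functional |.|^r *)

Section fuzzy_set_constructions.
Context {R : realType} {m : nat}.
Implicit Types (u v : 'rV[R]_m -> R) (K : set 'rV[R]_m).

Lemma ebounded_cut0 u (M : R) : (forall x, 0 < u x -> enorm x <= M) ->
  ebounded (fuzzy_cut u 0).
Proof.
move=> uM; exists M => x; rewrite /fuzzy_cut eqxx.
have sub : [set x | 0 < u x] `<=` [set y | enorm (0 - y) <= M].
  by move=> y /= /uM; rewrite sub0r enormN.
by move=> /(closure_subset sub)/closed_enorm_le /=; rewrite sub0r enormN.
Qed.

Lemma level_indic K a : 0 < a <= 1 -> level \1_K a = K.
Proof.
move=> /andP[a0 a1]; apply/seteqP; split=> x; rewrite /level/= indicE.
  by case: (boolP (x \in K)) => [|_]; rewrite ?inE// leNgt a0.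
by move=> Kx; rewrite mem_set.
Qed.

Lemma level_fuzzy_max u v a : level (fuzzy_max u v) a = level u a `|` level v a.
Proof.
by apply/seteqP; split=> x; rewrite /level/fuzzy_max/= le_max;
  [move/orP|move=> h; apply/orP].
Qed.

Lemma indic_FB K : closed K -> K !=set0 -> ebounded K ->
  exists w : FB R m, w = \1_K :> (_ -> _).
Proof.
move=> cK [x0 Kx0] [M KM].
have fu : fuzzy_set (\1_K : 'rV[R]_m -> R).
  by move=> x; rewrite indicE; case: (_ \in _); rewrite ?lexx ler01.
have nu : fuzzy_normal (\1_K : 'rV[R]_m -> R).
  by exists x0; rewrite indicE mem_set.
have su : upper_semicontinuous (\1_K : 'rV[R]_m -> R).
  move=> x a; rewrite indicE; case: (boolP (x \in K)) => [_|/negP xK] xa.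
    apply: filterS (@filterT _ (nbhs x) _) => y _.
    by apply: le_lt_trans xa; case/andP: (fu y).
  have : nbhs x (~` K).
    by apply: open_nbhs_nbhs; split; [exact: closed_openC|rewrite /=; rewrite inE in xK].
  by apply: filterS => y yK; rewrite indicE memNset.
have bu : ebounded (fuzzy_cut (\1_K : 'rV[R]_m -> R) 0).
  apply: (@ebounded_cut0 _ M) => x; rewrite indicE.
  by case: (boolP (x \in K)) => [|_]; rewrite ?ltxx// inE => /KM.
by exists (MkFB fu nu su bu).
Qed.

Lemma fuzzy_max_FB (u v : FB R m) :
  exists w : FB R m, w = fuzzy_max u v :> (_ -> _).
Proof.
have fw : fuzzy_set (fuzzy_max u v).
  by move=> x; rewrite /fuzzy_max le_max FB_ge0 ge_max !FB_le1.
have nw : fuzzy_normal (fuzzy_max u v).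
  have [x ux] := FB_normal u; exists x.
  by rewrite /fuzzy_max ux max_l// FB_le1.
have sw : upper_semicontinuous (fuzzy_max u v).
  move=> x a; rewrite gt_max => /andP[/(@FB_usc _ _ u) ua /(@FB_usc _ _ v) va].
  by apply: filterS2 ua va => y ua va; rewrite /fuzzy_max gt_max ua.
have [M uM] := level_bounded u; have [N vN] := level_bounded v.
have bw : ebounded (fuzzy_cut (fuzzy_max u v) 0).
  apply: (@ebounded_cut0 _ (Num.max M N)) => x.
  rewrite lt_max le_max => /orP[ux|vx].
    by rewrite (uM (u x))// /level/=.
  by rewrite (vN (v x)) ?orbT// /level/=.
by exists (MkFB fw nw sw bw).
Qed.

Lemma closed_eball r : closed (@eball R m r).
Proof.
have -> : eball r = [set y : 'rV[R]_m | enorm (0 - y) <= r].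
  by apply/seteqP; split=> y /=; rewrite /eball/= sub0r enormN.
exact: closed_enorm_le.
Qed.

Lemma eball_nonempty_bounded (r : R) : 0 < r -> nonempty_bounded (@eball R m r).
Proof.
move=> r0; split; last by exists r.
by exists 0; rewrite /eball/= enorm0 ltW.
Qed.

Lemma eball_FB (r : R) : 0 < r -> exists w : FB R m, w = \1_(eball r) :> (_ -> _).
Proof.
move=> /eball_nonempty_bounded[? ?].
by apply: indic_FB => //; exact: closed_eball.
Qed.

Lemma origin_FB : exists w : FB R m, w = \1_[set 0] :> (_ -> _).
Proof.
apply: indic_FB; last by exists 0 => x ->; rewrite enorm0.
  exact: (@accessible_closed_set1 _ (hausdorff_accessible (@norm_hausdorff R _))).
by exists 0.
Qed.

(* The integrand of [excess p r u] is the distance from the [a]-level of [u] to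
   the ball, as the set being compared with the ball contains it. *)
Definition ball_excess (r : R) u (a : R) : R :=
  rhausdorff (level u a `|` eball r) (eball r).

(** Both arguments of [dp] in [excess] are realised in [FB], so the measurability proved for
    [level_dist] carries over to [ball_excess]. *)
Lemma excessE (p r : R) (u : FB R m) : 1 <= p -> 0 < r ->
  exists w b : FB R m, [/\ excess p r u = dp p w b,
    forall a, 0 < a <= 1 -> level w a = level u a `|` eball r &
    forall a, 0 < a <= 1 -> level b a = eball r].
Proof.
move=> p1 r0; have [b bE] := eball_FB r0; have [w wE] := fuzzy_max_FB u b.
exists w, b; split=> [|a a01|a a01]; first by rewrite wE bE.
  by rewrite wE level_fuzzy_max bE level_indic.
by rewrite bE level_indic.
Qed.

Lemma union_ball_nonempty_bounded (r a : R) (u : FB R m) : 0 < r -> 0 < a <= 1 ->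
  nonempty_bounded (level u a `|` eball r).
Proof.
move=> r0 /(level_nonempty_bounded u)[[x ux] [M uM]].
split; first by exists x; left.
exists (Num.max M r) => y [/uM yM|yr]; rewrite le_max; first by rewrite yM.
by apply/orP; right.
Qed.

Lemma ball_excess_lt (r a e : R) (u : FB R m) : 0 < r -> 0 < a <= 1 ->
  ball_excess r u a < e -> in_fattening e (level u a) (eball r).
Proof.
move=> r0 a01 ue x ux.
have [h _] := rhausdorff_lt (union_ball_nonempty_bounded u r0 a01)
  (eball_nonempty_bounded r0) ue.
by apply: h; left.
Qed.

Lemma ball_excess_le (r a e : R) (u : FB R m) : 0 < r -> 0 < a <= 1 -> 0 < e ->
  in_fattening e (level u a) (eball r) -> ball_excess r u a <= e.
Proof.
move=> r0 a01 e0 ue; apply: rhausdorff_le.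
- exact: union_ball_nonempty_bounded.
- exact: eball_nonempty_bounded.
- by move=> x [/ue//|xr]; exact: (sub_in_fattening e0 (@subset_refl _ _) xr).
- by apply: sub_in_fattening => // x ?; right.
Qed.

Lemma ball_excess_ge0 (r a : R) (u : FB R m) : 0 < r -> 0 < a <= 1 ->
  0 <= ball_excess r u a.
Proof.
move=> r0 a01; apply: rhausdorff_ge0.
by case: (union_ball_nonempty_bounded u r0 a01).
Qed.

Lemma level_enorm_le (r a : R) (u : FB R m) x : 0 < r -> 0 < a <= 1 ->
  level u a x -> enorm x <= r + ball_excess r u a.
Proof.
move=> r0 a01 ux; apply/ler_addgt0Pr => e e0.
have [|y yr xy] := @ball_excess_lt r a (ball_excess r u a + e) u r0 a01 _ x ux.
  by rewrite ltrDl.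
have := enormD y (x - y); rewrite addrC subrK.
by move: yr; rewrite /eball/=; lra.
Qed.

Lemma ball_excess_anti (r a b : R) (u : FB R m) : 0 < r -> 0 < a -> a <= b ->
  b <= 1 -> ball_excess r u b <= ball_excess r u a.
Proof.
move=> r0 a0 ab b1; apply/ler_addgt0Pr => e e0.
have a01 : 0 < a <= 1 by rewrite a0 (le_trans ab).
have b01 : 0 < b <= 1 by rewrite (lt_le_trans a0).
apply: ball_excess_le => //.
  by have := ball_excess_ge0 u r0 a01; lra.
move=> x /(level_le ab) ux; apply: (ball_excess_lt r0 a01 _ ux).
by rewrite ltrDl.
Qed.

Lemma ball_excess_le_dist (r a : R) (u v : FB R m) : 0 < r -> 0 < a <= 1 ->
  level v a `<=` eball r -> ball_excess r u a <= level_dist u v a.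
Proof.
move=> r0 a01 vr; apply/ler_addgt0Pr => e e0.
have := level_dist_ge0 u v a01 => d0.
apply: ball_excess_le => //; first lra.
have [|uv _] := rhausdorff_lt (level_nonempty_bounded u a01)
  (level_nonempty_bounded v a01) (_ : _ < level_dist u v a + e).
  by rewrite ltrDl.
by move=> x /uv[y /vr]; exists y.
Qed.

Lemma excess_Lpnorm (p r : R) (u : FB R m) : 1 <= p -> 0 < r ->
  measurable_fun `](0 : R), 1] (ball_excess r u) /\
  excess p r u = Lpnorm p `]0, 1] (ball_excess r u).
Proof.
move=> p1 r0; have p0 : 0 < p by exact: lt_le_trans p1.
have [w [b [-> wl bl]]] := excessE u p1 r0.
have E : {in `](0 : R), 1]%classic, level_dist w b =1 ball_excess r u}.
  by move=> a; rewrite inE /= in_itv/= => a01; rewrite /level_dist wl// bl.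
split; first by apply: eq_measurable_fun E _; exact: measurable_level_dist.
have d0 a : `](0 : R), 1]%classic a -> 0 <= level_dist w b a.
  by rewrite /= in_itv/=; exact: level_dist_ge0.
have e0 a : `](0 : R), 1]%classic a -> 0 <= ball_excess r u a.
  by rewrite /= in_itv/=; exact: ball_excess_ge0.
rewrite (dpE p1) (LpnormE p0 d0) (LpnormE p0 e0).
apply: (congr1 (fun z => (z `^ p^-1)%E)); apply: eq_integral => a aI.
by rewrite (E a aI).
Qed.

End fuzzy_set_constructions.

(** * Sequences in (F_B, d_p) *)

Lemma extract_subsequence (P : nat -> nat -> Prop) :
  (forall k N, exists2 n, (N <= n)%N & P k n) ->
  exists2 phi : nat -> nat, {homo phi : i j / (i < j)%N} &
    forall k, P k (phi k).
Proof.
move=> exP.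
have /choice[f fP] : forall kN : nat * nat, exists n, (kN.2 <= n)%N /\ P kN.1 n.
  by move=> [k N]; have [n ? ?] := exP k N; exists n.
pose phi := fix phi k := if k is k'.+1 then f (k, (phi k').+1) else f (0%N, 0%N).
exists phi; last first.
  by case=> [|k]; [case: (fP (0, 0)%N)|case: (fP (k.+1, (phi k).+1))].
apply: (homo_ltn ltn_trans).
by move=> k; have [] := fP (k.+1, (phi k).+1).
Qed.

Lemma homo_ltn_ge_id (phi : nat -> nat) :
  {homo phi : i j / (i < j)%N} -> forall n, (n <= phi n)%N.
Proof.
move=> phiI; elim=> // n IH; apply: leq_ltn_trans IH _; exact: phiI.
Qed.

Lemma near_subseq (phi : nat -> nat) (P : nat -> Prop) :
  {homo phi : i j / (i < j)%N} ->
  (\forall n \near \oo, P n) -> \forall n \near \oo, P (phi n).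
Proof.
move=> /homo_ltn_ge_id phin [N _ NP]; exists N => // n /= Nn; apply: NP => /=.
exact: leq_trans Nn _.
Qed.

(** * Neighbourhoods and sequential compactness for d_p *)

Section dp_topology_lemmas.
Context {R : realType} {m : nat} (p : R).
Hypothesis p1 : 1 <= p.
Local Notation T := (@FBdp R m p).
Implicit Types (u v w : T) (U : set T).

Lemma dp_triangle_lt v u w (a b : R) : (dp p u v < a%:E)%E ->
  (dp p v w < b%:E)%E -> (dp p u w < (a + b)%:E)%E.
Proof.
by move=> uv vw; apply: le_lt_trans (dp_triangle p1 v u w) _;
  rewrite EFinD; exact: lteD.
Qed.

Lemma nbhs_dpP u (A : set T) : nbhs u A <->
  exists2 e : R, 0 < e & forall v : T, (dp p u v < e%:E)%E -> A v.
Proof.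
split.
  rewrite nbhsE => -[B [oB Bu] BA].
  have [e e0 eB] := (oB : dp_open B) u Bu.
  by exists e => // v /eB/BA.
move=> [e e0 eA]; rewrite nbhsE.
(* The interior of [A] in terms of d_p-balls; the triangle inequality makes it open. *)
exists [set v : T | exists2 d : R, 0 < d & forall w : T, (dp p v w < d%:E)%E -> A w].
  split; last by exists e.
  suff : dp_open [set v : T | exists2 d : R, 0 < d &
    forall w : T, (dp p v w < d%:E)%E -> A w] by [].
  move=> v [d d0 dA]; exists (d / 2) => [|w vw]; first by rewrite divr_gt0.
  exists (d / 2) => [|x wx]; first by rewrite divr_gt0.
  by apply: dA; have := dp_triangle_lt vw wx; rewrite -splitr.
by move=> v [d d0]; apply; rewrite dpxx// lte_fin.
Qed.

Lemma nbhs_dp_ball u (e : R) : 0 < e -> nbhs u [set v : T | (dp p u v < e%:E)%E].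
Proof. by move=> e0; apply/nbhs_dpP; exists e. Qed.

Lemma dp_hausdorff : hausdorff_space T.
Proof.
move=> u v uv; apply: (dp_eq0 p1); apply/eqP; rewrite eq_le dp_ge0// andbT.
apply/lee_addgt0Pr => e e0; rewrite add0e.
have e20 : 0 < e / 2 by rewrite divr_gt0.
have [w [/= uw vw]] := uv _ _ (nbhs_dp_ball u e20) (nbhs_dp_ball v e20).
by rewrite (splitr e) ltW//; apply: dp_triangle_lt uw _; rewrite dp_sym.
Qed.

(** A cluster point has terms of arbitrarily large index in each ball of radius 1/(k+1) about it. *)
Lemma compact_dp_subseq U (u_ : nat -> T) : compact U ->
  (forall n, U (u_ n)) -> exists2 v, U v &
  exists2 phi : nat -> nat, {homo phi : i j / (i < j)%N} &
    forall e : R, 0 < e -> \forall n \near \oo, (dp p (u_ (phi n)) v < e%:E)%E.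
Proof.
move=> cU Uu; have FU : (u_ @ \oo) U by exists 0%N => // n _; exact: Uu.
have [v [Uv clv]] := cU _ _ FU.
exists v => //.
have [k N|phi phiI phiP] := @extract_subsequence
    (fun k n => (dp p (u_ n) v < (k.+1%:R^-1)%:E)%E).
  have k0 : 0 < (k.+1%:R^-1 : R) by rewrite invr_gt0.
  have uN : (u_ @ \oo) [set u_ n | n in [set n | (N <= n)%N]].
    by exists N => // n /= Nn; exists n.
  have [_ [[n /= Nn <-] nv]] := clv _ _ uN (nbhs_dp_ball v k0).
  by exists n; [exact: Nn|rewrite (dp_sym p1); exact: nv].
exists phi => // e e0; near=> n; apply: lt_trans (phiP n) _.
rewrite lte_fin; near: n; exact: near_infty_natSinv_lt (PosNum e0).
Unshelve. all: by end_near. Qed.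

(** Total boundedness and completeness in ultrafilter form. For each e the ultrafilter contains an
    e-ball centred in [U]: otherwise a greedy choice gives an e-separated sequence, two of whose
    terms would be e/2-close to the limit of a subsequence. The centres for e = 1/(k+1) then
    subconverge to a limit of the ultrafilter. *)
Lemma dp_subseq_compact U :
  (forall u_ : nat -> T, (forall n, U (u_ n)) -> exists2 v, U v &
    exists2 phi : nat -> nat, {homo phi : i j / (i < j)%N} &
    forall e : R, 0 < e -> \forall n \near \oo, (dp p (u_ (phi n)) v < e%:E)%E) ->
  compact U.
Proof.
move=> sU; rewrite compact_ultra => F FU UF.
have FPF : ProperFilter F by exact: ultra_proper.
have ballF (e : R) : 0 < e -> exists2 u, U u & F [set v : T | (dp p u v < e%:E)%E].
  move=> e0; apply: contrapT => /forall2NP noball.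
  have sep (s : seq T) : exists v, U v /\
      forall u, u \in s -> U u -> ~ (dp p u v < e%:E)%E.
    suff : F [set v : T | forall u : T, u \in s -> U u -> ~ (dp p u v < e%:E)%E].
      by move=> /(filterI UF)/filter_ex[v [Uv vs]]; exists v.
    elim: s => [|w s IH]; first by apply: filterS UF.
    (* A [w] outside [U] excludes nothing; otherwise its ball is not in [F], so the complement
       is. *)
    have : F [set v : T | U w -> ~ (dp p w v < e%:E)%E].
      have [nUw|nF] := noball w; first by apply: filterS UF => v _ /nUw.
      have [FB|FC] := in_ultra_setVsetC [set v : T | (dp p w v < e%:E)%E] FU.
        by case: (nF FB).
      by apply: filterS FC => v + _.
    apply: filterS2 IH => v vs wv u; rewrite in_cons => /predU1P[->//|]; exact: vs.
  have /choice[f fP] := sep.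
  pose l := fix l n := if n is n'.+1 then f (l n') :: l n' else [::].
  pose x n := f (l n).
  have xl i j : (i < j)%N -> x i \in l j.
    elim: j => // j IH; rewrite ltnS leq_eqVlt => /predU1P[->|/IH ij].
      exact: mem_head.
    by rewrite in_cons ij orbT.
  have [|v _ [phi phiI phiv]] := sU x; first by move=> n; case: (fP (l n)).
  have e20 : 0 < e / 2 by rewrite divr_gt0.
  have [N _ Nv] := phiv _ e20.
  have vN := Nv N (leqnn N); have vN1 := Nv N.+1 (leqnSn N).
  have [_ /(_ (x (phi N)))] := fP (l (phi N.+1)); apply.
  - exact/xl/phiI.
  - by case: (fP (l (phi N))).
  - by rewrite (splitr e); apply: dp_triangle_lt vN _; rewrite dp_sym.
have /choice[x xP] : forall k, exists u, U u /\
    F [set v : T | (dp p u v < (k.+1%:R^-1)%:E)%E].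
  by move=> k; have [|u Uu Fu] := ballF k.+1%:R^-1; [rewrite invr_gt0|exists u].
have [|v Uv [phi phiI phiv]] := sU x; first by move=> n; case: (xP n).
exists v; split=> // A /nbhs_dpP[e e0 eA].
have e20 : 0 < e / 2 by rewrite divr_gt0.
have [n [nv ne]] : exists n, (dp p (x (phi n)) v < (e / 2)%:E)%E /\
    (phi n).+1%:R^-1 < e / 2.
  have near2 := near_subseq phiI (near_infty_natSinv_lt (PosNum e20)).
  have /filter_ex[n [? ?]] : \forall n \near \oo,
      (dp p (x (phi n)) v < (e / 2)%:E)%E /\ (phi n).+1%:R^-1 < e / 2.
    by apply: filterS2 (phiv _ e20) near2 => n; split.
  by exists n.
have [_] := xP (phi n); apply: filterS => w /= xw; apply: eA.
rewrite (splitr e); apply: (@dp_triangle_lt (x (phi n))).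
  by rewrite dp_sym.
by apply: lt_trans xw _; rewrite lte_fin.
Qed.

End dp_topology_lemmas.

(** * Selection of a subsequence *)

(** An ultrafilter finer than the one at infinity yields all the limits at once, in place of a
    diagonal extraction; [phi k] is then an index at which the first k sequences are within 1/(k+1)
    of their limits. *)
Lemma bounded_family_subseq {R : realType} (s : nat -> nat -> R) :
  (forall i n, 0 <= s i n <= 1) ->
  exists S : nat -> R, exists2 phi : nat -> nat, {homo phi : i j / (i < j)%N} &
    forall i (e : R), 0 < e -> \forall n \near \oo, `|s i (phi n) - S i| < e.
Proof.
move=> s01; have [G [GU ooG]] := ultraFilterLemma (F := \oo) _.
have /choice[S SG] : forall i, exists l, forall e : R, 0 < e ->
    G [set n | `|s i n - l| < e].
  move=> i; have sG : (s i @ G) `[0, 1]%classic.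
    suff : G (s i @^-1` `[0, 1]%classic) by [].
    by apply: filterS (@filterT _ G _) => n _; rewrite /= in_itv/= s01.
  have [l [_ lcl]] := @segment_compact R 0 1 _ _ sG.
  exists l => e e0; have [//|nG] := in_ultra_setVsetC [set n | `|s i n - l| < e] GU.
  have sGe : (s i @ G) (~` [set y | `|y - l| < e]) by [].
  have [x [/= xe]] := lcl _ _ sGe (nbhsx_ballx l e e0).
  by rewrite /ball/= distrC => le; case: xe.
have SGk k : G [set n | forall i, (i < k)%N -> `|s i n - S i| < k.+1%:R^-1].
  have k0 : 0 < (k.+1%:R^-1 : R) by rewrite invr_gt0.
  (* Induction on the number of sequences only; the tolerance 1/(k+1) stays fixed. *)
  elim: {1}k => [|j IH]; first by apply: filterS (@filterT _ G _) => n _ i.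
  apply: filterS2 IH (SG j _ k0) => n nj sj i.
  by rewrite ltnS leq_eqVlt => /predU1P[->//|/nj].
have [k N|phi phiI phiP] := @extract_subsequence
    (fun k n => forall i, (i < k)%N -> `|s i n - S i| < k.+1%:R^-1).
  have GN : G [set n | (N <= n)%N] by apply: ooG; exists N.
  have [n [? ?]] := filter_ex (filterI GN (SGk k)).
  by exists n.
exists S, phi => // i e e0; near=> n.
apply: lt_trans (phiP n i _) _; first by near: n; exact: nbhs_infty_gt.
by near: n; exact: near_infty_natSinv_lt (PosNum e0).
Unshelve. all: by end_near. Qed.

Section selection.
Context {R : realType} {m : nat}.

(* Up to a subsequence, the suprema of the [v n] over each set of a countable
   base converge; [u x] is the infimum of these limits over the basic
   neighbourhoods of [x]. *)
Lemma hypograph_selection (v : nat -> FB R m) :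
  exists2 phi : nat -> nat, {homo phi : i j / (i < j)%N} &
  exists u : 'rV[R]_m -> R, [/\ fuzzy_set u, upper_semicontinuous u,
    forall K a, compact K -> (forall x, K x -> u x < a) ->
      \forall n \near \oo, forall x, K x -> v (phi n) x < a &
    forall x A b, nbhs x A -> 0 <= b < u x ->
      \forall n \near \oo, exists2 y, A y & b < v (phi n) y].
Proof.
have [B baseB] := @countable_base R m.
pose s i n := sup [set v n x | x in B i].
have ubv i n : has_ubound [set v n x | x in B i].
  by exists 1 => _ [x _ <-]; exact: FB_le1.
have vs i n x : B i x -> v n x <= s i n by move=> Bx; apply: ub_le_sup => //; exists x.
have s01 i n : 0 <= s i n <= 1.
  (* Over an empty basic set [sup] takes its default value 0, which is still in [0, 1]. *)
  have [Bi0|/set0P[x Bx]] := eqVneq (B i) set0.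
    by rewrite /s Bi0 image_set0 sup0 lexx ler01.
  rewrite (le_trans (FB_ge0 (v n) x) (vs _ _ _ Bx))/=.
  by apply: ge_sup => [|_ [y _ <-]]; [exists (v n x); exists x|exact: FB_le1].
have [S [phi phiI Scvg]] := bounded_family_subseq s01.
have S_ge0 i : 0 <= S i.
  apply/ler_addgt0Pr => e e0; have /filter_ex[n] := Scvg i _ e0.
  by have /andP[? _] := s01 i (phi n); rewrite ltr_norml => /andP[? ?]; lra.
have S_le1 i : S i <= 1.
  apply/ler_addgt0Pr => e e0; have /filter_ex[n] := Scvg i _ e0.
  by have /andP[_ ?] := s01 i (phi n); rewrite ltr_norml => /andP[? ?]; lra.
pose u (x : 'rV[R]_m) := inf [set S i | i in [set i | nbhs x (B i)]].
have J0 (x : 'rV[R]_m) : [set S i | i in [set i | nbhs x (B i)]] !=set0.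
  by have [i Bi _] := baseB x setT filterT; exists (S i); exists i.
have uS (x : 'rV[R]_m) i : nbhs x (B i) -> u x <= S i.
  by move=> Bi; apply: ge_inf; [exists 0 => _ [j _ <-]|exists i].
have uS_lt (x : 'rV[R]_m) a : u x < a -> exists2 i, nbhs x (B i) & S i < a.
  by move=> /(inf_lt (J0 x))[_ [i Bi <-] Sa]; exists i.
exists phi => //; exists u; split.
- move=> x; apply/andP; split.
    by apply: lb_le_inf (J0 x) _ => _ [i _ <-].
  by have [i Bi _] := baseB x setT filterT; exact: le_trans (uS _ _ Bi) _.
- move=> x a /uS_lt[i Bi Sa].
  have := nbhs_interior Bi; apply: filterS => y yB.
  exact: le_lt_trans (uS _ _ yB) Sa.
(* This clause and the next are the two halves of the convergence of hypographs: an upper bound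
   uniform on compact sets, and nearby points with values at least almost as large. *)
- move=> K a /compact_near_coveringP cK Ka.
  apply: cK => x /Ka/uS_lt[i Bi Sa].
  have Sa0 : 0 < a - S i by rewrite subr_gt0.
  exists (B i, [set n | `|s i (phi n) - S i| < a - S i]).
    by split => //; exact: Scvg.
  move=> [y n] /= [By]; rewrite ltr_norml => /andP[_ sa].
  by apply: le_lt_trans (vs _ _ _ By) _; rewrite ltrD2r in sa.
- move=> x A b xA /andP[b0 bu]; have [i Bi BA] := baseB _ _ xA.
  have Sb0 : 0 < S i - b by rewrite subr_gt0 (lt_le_trans bu (uS _ _ Bi)).
  have := Scvg i _ Sb0; apply: filterS => n.
  rewrite ltr_norml => /andP[sb _].
  have bs : b < s i (phi n) by lra.
  have [_ [y By <-] bv] : exists2 z, [set v (phi n) x | x in B i] z & b < z.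
    by apply: sup_gt bs; exists (v (phi n) x); exists x => //; exact: nbhs_singleton.
  by exists y => //; exact: BA.
Qed.

End selection.

(** * Convergence in d_p of the selected subsequence *)

Section selection_convergence.
Context {R : realType} {m : nat} (p : R).
Hypothesis p1 : 1 <= p.
Local Notation mu := (@lebesgue_measure R).

Let p0 : 0 < p. Proof. exact: lt_le_trans p1. Qed.

(* The excess is nonincreasing in the level, so that its value at [a] is
   controlled by its integral over ]0, a]. *)
Lemma excess_cvg_pointwise (v : nat -> FB R m) (r : R) : 0 < r ->
  (forall e : R, 0 < e -> \forall n \near \oo, (excess p r (v n) < e%:E)%E) ->
  forall a e : R, 0 < a <= 1 -> 0 < e ->
    \forall n \near \oo, ball_excess r (v n) a < e.
Proof.
move=> r0 vr a e /andP[a0 a1] e0.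
(* The L^p norm of the constant e over ]0, a]: an excess of at least e at level a forces at least
   this much. *)
have d0 : 0 < (e `^ p * a) `^ p^-1 by rewrite powR_gt0// mulr_gt0// powR_gt0.
apply: filterS (vr _ d0) => n; apply: contraTT; rewrite -!leNgt => ea.
have [mb ->] := excess_Lpnorm (v n) p1 r0.
have -> : ((e `^ p * a) `^ p^-1)%:E = Lpnorm p `]0, a] (cst e).
  have ce0 x : `](0 : R), a]%classic x -> 0 <= cst e x by rewrite /= ltW.
  rewrite (LpnormE p0 ce0); under eq_integral do rewrite /=.
  rewrite integral_cst//.
  rewrite [X in (_ * X)%E](_ : _ = a%:E) -?EFinM//.
  by have := @lebesgue_measure_itv R `]0%R, a]; rewrite /= lte_fin a0 oppr0 adde0.
have sub : `]0, a] `<=` `](0 : R), 1].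
  by move=> x /=; rewrite !in_itv/= => /andP[->]/= /le_trans; exact.
have be0 x : `](0 : R), 1]%classic x -> 0 <= ball_excess r (v n) x.
  by rewrite /= in_itv/=; exact: ball_excess_ge0.
apply: (@le_trans _ _ (Lpnorm p `]0, a] (ball_excess r (v n)))).
  apply: le_Lpnorm => //; first exact: measurable_funS mb.
  move=> x /=; rewrite in_itv/= => /andP[x0 xa]; rewrite (ltW e0)/=.
  by apply: le_trans ea _; exact: ball_excess_anti.
exact: Lpnorm_subset.
Qed.

Lemma excess_cvg_subseq (v : nat -> FB R m) (r : R) : 0 < r ->
  (forall e : R, 0 < e -> \forall n \near \oo, (excess p r (v n) < e%:E)%E) ->
  exists w : FB R m, exists2 phi : nat -> nat, {homo phi : i j / (i < j)%N} &
    forall e : R, 0 < e -> \forall n \near \oo, (dp p (v (phi n)) w < e%:E)%E.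
Proof.
move=> r0 vr; have [phi phiI [u [fu su uK uA]]] := hypograph_selection v.
have vr' e e0 := near_subseq phiI (vr e e0).
have vb (a e : R) (a01 : 0 < a <= 1) (e0 : 0 < e) :=
  near_subseq phiI (excess_cvg_pointwise r0 vr a01 e0).
have one01 : 0 < (1 : R) <= 1 by rewrite ltr01 lexx.
(* Near a point x with |x| > r and u x > 0 there would be points of the levels of [v (phi n)] at u x
   / 2, which eventually lie closer to the ball than that. *)
have usupp x : 0 < u x -> enorm x <= r.
  move=> ux; rewrite leNgt; apply/negP => xr.
  have d0 : 0 < (enorm x - r) / 2 by rewrite divr_gt0// subr_gt0.
  have bu : 0 <= u x / 2 < u x by apply/andP; split; lra.
  have b01 : 0 < u x / 2 <= 1.
    by have /andP[_ ux1] := fu x; apply/andP; split; lra.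
  have [n [[y xy vy] yr]] := filter_ex (filterI
    (uA x _ _ (nbhs_enorm x d0) bu) (vb _ _ b01 d0)).
  have := level_enorm_le r0 b01 (ltW vy : level _ _ y).
  have := enorm_triangle y x 0; rewrite !subr0; lra.
(* Otherwise u < 1 on the ball of radius r + 1, and eventually [v (phi n)] < 1 there too, although
   that ball comes to contain its whole level at 1. *)
have [x0 ux0] : fuzzy_normal u.
  apply: contrapT => nu.
  have u1 x : [set y : 'rV[R]_m | enorm (0 - y) <= r + 1] x -> u x < 1.
    move=> _; have /andP[_] := fu x; rewrite le_eqVlt => /predU1P[ux|//].
    by case: nu; exists x.
  have [n [vK vn]] := filter_ex (filterI
    (uK _ _ (@enorm_ball_compact _ _ _ _) u1) (vb 1 1 one01 ltr01)).
  have [x vx] := FB_normal (v (phi n)).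
  suff xr : enorm (0 - x) <= r + 1 by have := vK x xr; rewrite vx ltxx.
  have vx1 : level (v (phi n)) 1 x by rewrite /level/= vx.
  have := level_enorm_le r0 one01 vx1.
  by rewrite sub0r enormN; lra.
have nu : fuzzy_normal u by exists x0.
pose w := MkFB fu nu su (ebounded_cut0 usupp).
exists w, phi; first exact: phiI.
have wr (a : R) : 0 < a -> level w a `<=` eball r.
  by move=> a0 x /(lt_le_trans a0); exact: usupp.
have [B baseB] := @countable_base R m.
(* The levels at which [u] has a local maximum, where the cuts may jump. *)
pose C := range (fun i => sup [set u x | x in B i]).
have close1 (a e : R) : 0 < a <= 1 -> 0 < e ->
    \forall n \near \oo, in_fattening e (level (v (phi n)) a) (level w a).
  move=> a01 e0.
  pose K := [set x : 'rV[R]_m | enorm (0 - x) <= r + 1] `&`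
    [set x | forall y, level w a y -> e <= enorm (y - x)].
  have cK : compact K.
    by apply: compact_closedI; [exact: enorm_ball_compact|exact: closed_enorm_ge].
  have Ka x : K x -> u x < a.
    move=> [_ /= xK]; rewrite ltNge; apply/negP => /xK.
    by rewrite subrr enorm0 leNgt e0.
  apply: filterS2 (uK _ _ cK Ka) (vb _ _ a01 ltr01) => n vK vn x vx.
  apply: contrapT => /forall2NP h.
  have : v (phi n) x < a.
    apply: vK; split.
      by have := level_enorm_le r0 a01 vx; rewrite /= sub0r enormN; lra.
    by move=> y /= wy; rewrite leNgt; apply/negP; have [//|] := h y; rewrite enormB.
  by rewrite ltNge => /negP; apply.
have close2 (a e : R) : 0 < a <= 1 -> ~ C a -> 0 < e ->
    \forall n \near \oo, in_fattening e (level w a) (level (v (phi n)) a).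
  move=> a01 nCa e0; have /andP[a0 a1] := a01.
  have /compact_near_coveringP cw := level_compact (u := w) a0.
  apply: cw => x wx.
  have e20 : 0 < e / 2 by rewrite divr_gt0.
  have e40 : 0 < e / 4 by rewrite divr_gt0.
  (* Only a strict inequality a < u y passes to [v (phi n)]. Without such a y, a is the maximum of u
     over a basic neighbourhood of x, hence in [C]. *)
  have [y ay xy] : exists2 y, a < u y & enorm (x - y) < e / 2.
    apply: contrapT => /forall2NP h; apply: nCa.
    have [i Bi Bx] := baseB _ _ (nbhs_enorm x e20).
    have uBa y : B i y -> u y <= a.
      by move=> /Bx xy; rewrite leNgt; apply/negP => ?; case: (h y).
    have Bix := nbhs_singleton Bi.
    exists i => //; apply/eqP; rewrite eq_le; apply/andP; split.
      by apply: ge_sup => [|_ [y /uBa ? <-]//]; exists (u x); exists x.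
    apply: (@le_trans _ _ (u x)) => //; apply: ub_le_sup; last by exists x.
    by exists a => _ [y /uBa ? <-].
  have ay' : 0 <= a < u y by rewrite ltW.
  exists ([set x' | enorm (x - x') < e / 4],
    [set n | exists2 z, enorm (y - z) < e / 4 & a < v (phi n) z]).
    by split; [exact: nbhs_enorm|exact: uA _ _ _ (nbhs_enorm y e40) ay'].
  move=> [x' n] /= [xx' [z yz az]]; exists z; first exact: ltW.
  have := enorm_triangle x x' z; have := enorm_triangle y x z.
  by rewrite (enormB x' x); lra.
pose H n := level_dist (v (phi n)) w.
pose k n a := Num.min (H n a) (2 * r).
have H0 n a : 0 < a <= 1 -> 0 <= H n a by exact: level_dist_ge0.
have Hk n a : 0 < a <= 1 -> H n a <= ball_excess r (v (phi n)) a + k n a.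
  move=> a01; have E0 := ball_excess_ge0 (v (phi n)) r0 a01.
  rewrite /k; have [_|_] := leP (H n a) (2 * r); first by rewrite lerDr.
  (* When the minimum is 2r, any points of the two levels are within (r + excess) + r of each
     other. *)
  have nv := level_nonempty_bounded (v (phi n)) a01.
  have nw := level_nonempty_bounded w a01.
  have /andP[a0 _] := a01.
  apply/ler_addgt0Pr => e e0; apply: rhausdorff_le => // x.
    move=> vx; have [[y wy] _] := nw; exists y => //.
    have := level_enorm_le r0 a01 vx; have := wr _ a0 _ wy; rewrite /eball/=.
    by have := enormD x (- y); rewrite enormN; lra.
  move=> wx; have [[y vy] _] := nv; exists y => //.
  have := level_enorm_le r0 a01 vy; have := wr _ a0 _ wx; rewrite /eball/=.
  by have := enormD x (- y); rewrite enormN; lra.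
have mH n : measurable_fun `](0 : R), 1] (H n) by exact: measurable_level_dist.
have mk n : measurable_fun `](0 : R), 1] (k n).
  by apply: measurable_minr => //; exact: measurable_cst.
have kcvg : Lpnorm p `]0, 1] (k n) @[n --> \oo] --> 0%E.
  apply: (@Lpnorm_bounded_cvg0 _ _ (2 * r) C) => //.
  - exact: (sub_countable (card_image_le _ _)) (countableP _).
  - move=> n a a01; rewrite /k ge_min lexx orbT andbT le_min H0//=.
    by rewrite mulr_ge0// ltW.
  - move=> a a01 nCa; apply/cvgr0Pnorm_lt => e e0.
    have e20 : 0 < e / 2 by rewrite divr_gt0.
    apply: filterS2 (close1 _ _ a01 e20) (close2 _ _ a01 nCa e20) => n vw wv.
    have kn0 : 0 <= k n a by rewrite /k le_min H0// mulr_ge0// ltW.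
    rewrite ger0_norm//; apply: (@le_lt_trans _ _ (H n a)).
      by rewrite /k ge_min lexx.
    have : H n a <= e / 2.
      by apply: rhausdorff_le => //; exact: level_nonempty_bounded.
    lra.
move=> e e0; have e20 : 0 < e / 2 by rewrite divr_gt0.
have /cvge0P := kcvg => /(_ (fun n => Lpnorm_ge0 _ _ _)) /(_ _ e20) kn.
apply: filterS2 kn (vr' _ e20) => n kn.
have [mb ->] := excess_Lpnorm (v (phi n)) p1 r0 => vn.
rewrite dpE// (splitr e) EFinD; apply: le_lt_trans (lteD vn kn).
apply: le_trans (LpnormD p1 _ mb (mk n)) => //.
apply: (le_Lpnorm p1 _ (mH n) (measurable_funD mb (mk n))) => //.
by move=> a; rewrite /= in_itv/= => a01; rewrite H0//= Hk.
Qed.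

End selection_convergence.

(** * Necessary conditions *)

Section compact_consequences.
Context {R : realType} {m : nat} (p : R).
Hypothesis p1 : 1 <= p.
Local Notation T := (@FBdp R m p).
Implicit Types (u v : T) (U : set T).

(** A sequence whose n-th term is farther than n + 1 from the origin has no subsequence converging
    to some v, since eventually its distances are at most 1 + d_p(v, 0). *)
Lemma compact_p_mean_bounded U : compact U -> uniformly_p_mean_bounded U.
Proof.
move=> cU; have [z zE] := @origin_FB R m.
apply: contrapT => /forall2NP unb.
have /choice[u_ uP] : forall n : nat, exists u : T,
    U u /\ (n.+1%:R%:E < dp p u z)%E.
  move=> n; have [|/existsNP[u /not_implyP[Uu]]] := unb n.+1%:R.
    by rewrite ltr0n.
  by move=> /negP; rewrite -ltNge -zE; exists u.
have [|v _ [phi phiI uv]] := compact_dp_subseq p1 cU (u_ := u_).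
  by move=> n; case: (uP n).
have vo : dp p v z \is a fin_num by rewrite ge0_fin_numE ?dp_lty ?dp_ge0.
have [n [nv no]] := filter_ex (filterI (uv _ ltr01) (nbhs_infty_gtr (fine (dp p v z)))).
have [_] := uP (phi n); apply/negP; rewrite -leNgt.
apply: le_trans (dp_triangle p1 v _ _) _.
apply: le_trans (leeD (ltW nv) (lexx _)) _.
rewrite -(fineK vo) -EFinD lee_fin -natr1 addrC lerD2r.
by apply: le_trans (ltW no) _; rewrite ler_nat; exact: homo_ltn_ge_id.
Qed.

Lemma compact_ball_excess U (u_ : nat -> T) : compact U -> (forall n, U (u_ n)) ->
  exists2 r : R, 0 < r &
  exists2 phi : nat -> nat, {homo phi : i j / (i < j)%N} &
    excess p r (u_ (phi n)) @[n --> \oo] --> 0%E.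
Proof.
move=> cU Uu; have [v _ [phi phiI uv]] := compact_dp_subseq p1 cU Uu.
have [M vM] := level_bounded v.
(* M bounds the levels of the limit; the maximum with 1 makes the radius positive. *)
have r0 : 0 < Num.max M 1 by rewrite lt_max ltr01 orbT.
exists (Num.max M 1) => //; exists phi => //.
apply/cvge0P => [n|e e0].
  by have [_ ->] := excess_Lpnorm (u_ (phi n)) p1 r0; exact: Lpnorm_ge0.
apply: filterS (uv _ e0) => n; apply: le_lt_trans.
have [me ->] := excess_Lpnorm (u_ (phi n)) p1 r0; rewrite (dpE p1).
apply: le_Lpnorm => //; first exact: measurable_level_dist.
move=> a; rewrite /= in_itv/= => a01; rewrite ball_excess_ge0//=.
apply: ball_excess_le_dist => // x vx.
have /andP[a0 _] := a01.
by rewrite /eball/= le_max (vM _ _ a0 vx).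
Qed.

Let shift_dist (h : R) (u v : T) (a : R) := rhausdorff (level u a) (level v (a - h)).

Let measurable_shift_dist (h : R) u v : 0 <= h ->
  measurable_fun `]h, 1] (shift_dist h u v).
Proof.
move=> h0; have := @measurable_rhausdorff_level _ _ u v 0 h h.
rewrite !lexx h0 => /(_ isT isT); rewrite [X in measurable_fun _ X -> _](_ : _ =
  shift_dist h u v)//.
by apply/funext => a; rewrite /shift_dist subr0.
Qed.

Lemma FB_p_mean_left_continuous v (h : nat -> R) : (forall n, 0 <= h n) ->
  h n @[n --> \oo] --> 0 ->
  Lpnorm p `](h n), 1] (shift_dist (h n) v v) @[n --> \oo] --> 0%E.
Proof.
move=> h0 /cvgr0Pnorm_lt hcvg.
have sub n : `](h n), 1] `<=` `](0 : R), 1].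
  by move=> a /=; rewrite !in_itv/= => /andP[? ->]; rewrite andbT (le_lt_trans (h0 n)).
(* Extension by 0 brings the varying domains to the fixed interval ]0, 1], as dominated convergence
   requires. *)
pose f n := shift_dist (h n) v v \_ `](h n), 1].
have -> : (fun n => Lpnorm p `](h n), 1] (shift_dist (h n) v v)) =
    (fun n => Lpnorm p `]0, 1] (f n)).
  apply/funext => n; rewrite /Lpnorm; congr Lnorm; apply/funext => a /=.
  rewrite /f !patchE; case: (boolP (a \in `]0, 1]%classic)) => // /negP a01.
  by rewrite memNset// => /sub; rewrite -inE.
have [M vM] := rhausdorff_level_bounded v v.
have h01 n (a : R) : a \in `](h n), 1]%classic -> 0 < a <= 1 /\ 0 < a - h n <= 1.
  rewrite inE /= in_itv/= => /andP[? ?].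
  by have := h0 n; split; apply/andP; split; lra.
have one01 : 0 < (1 : R) <= 1 by rewrite ltr01 lexx.
have sd0 n (a : R) : a \in `](h n), 1]%classic -> 0 <= shift_dist (h n) v v a.
  by move=> /h01[a01 _]; apply: rhausdorff_ge0; case: (level_nonempty_bounded v a01).
have M0 : 0 <= M.
  apply: le_trans (vM 1 1 one01 one01).
  by apply: rhausdorff_ge0; case: (level_nonempty_bounded v one01).
apply: (@Lpnorm_bounded_cvg0 _ _ M set0) => //.
- move=> n; apply/measurable_restrict => //.
  rewrite setIC (setIidl (@sub n)); exact: measurable_shift_dist.
- move=> n a _; rewrite /f patchE; case: ifPn => [ah|_]; last by rewrite lexx.
  by rewrite sd0//=; have [? ?] := h01 _ _ ah; exact: vM.
- move=> a a01 _; apply/cvgr0Pnorm_lt => e e0.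
  have e20 : 0 < e / 2 by rewrite divr_gt0.
  have [d d0 dP] := level_left_continuous v a01 e20.
  have /andP[a0 _] := a01.
  have ad0 : 0 < Num.min a d by rewrite lt_min a0.
  apply: filterS (hcvg _ ad0) => n; rewrite ger0_norm// lt_min => /andP[ha hd].
  rewrite /f patchE; case: ifPn => [ah|_]; last by rewrite normr0.
  rewrite ger0_norm ?sd0//; apply: (@le_lt_trans _ _ (e / 2)); last by lra.
  by have hn0 := h0 n; apply: dP; [|apply/andP; split]; lra.
Qed.

(** Three thirds of eps: go from u at level a to v at a, to v at a - h, to u at a - h. The outer
    terms are bounded by d_p(u, v), the last one by translation; the middle one concerns the single
    limit v. *)
Lemma compact_equi_left_continuous U : compact U -> p_mean_equi_left_continuous U.
Proof.
move=> cU eps eps0; apply: contrapT => /forall2NP nd.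
have /choice[hu huP] : forall n : nat, exists hu : R * T,
    [/\ 0 <= hu.1 < n.+1%:R^-1, U hu.2 &
      (eps%:E <= Lpnorm p `](hu.1), 1%R] (shift_dist hu.1 hu.2 hu.2))%E].
  move=> n; have [|] := nd n.+1%:R^-1; first by rewrite invr_gt0.
  move=> /existsNP[h /not_implyP[hn /existsNP[u /not_implyP[Uu]]]].
  have /andP[h0 _] := hn.
  rewrite (cut_integralE p1) ?h0 ?lexx// => /negP; rewrite -leNgt => ?.
  by exists (h, u).
pose h n := (hu n).1; pose u_ n := (hu n).2.
have [|v _ [phi phiI uv]] := compact_dp_subseq p1 cU (u_ := u_).
  by move=> n; case: (huP n).
have h0 n : 0 <= h n by case: (huP n) => /andP[].
have hcvg : h (phi n) @[n --> \oo] --> 0.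
  apply/cvgr0Pnorm_lt => e e0; apply: (near_subseq phiI (P := fun n => `|h n| < e)).
  near=> n; rewrite ger0_norm//; case: (huP n) => /andP[_ hn] _ _.
  by apply: lt_trans hn _; near: n; exact: near_infty_natSinv_lt (PosNum e0).
have := FB_p_mean_left_continuous v (fun n => h0 (phi n)) hcvg.
move=> /cvge0P => /(_ (fun n => Lpnorm_ge0 _ _ _)) vh.
have e30 : 0 < eps / 3 by rewrite divr_gt0.
have [n [un vn]] := filter_ex (filterI (uv _ e30) (vh _ e30)).
move: (phi n) un vn => k uk vk.
case: (huP k) => _ _; apply/negP; rewrite -ltNge -/(h k) -/(u_ k).
have sub : `](h k), 1] `<=` `](0 : R), 1].
  by move=> a /=; rewrite !in_itv/= => /andP[? ->]; rewrite andbT (le_lt_trans (h0 k)).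
have h01 (a : R) : `](h k), 1]%classic a -> 0 < a <= 1 /\ 0 < a - h k <= 1.
  rewrite /= in_itv/= => /andP[? ?].
  by have := h0 k; split; apply/andP; split; lra.
have ld0 x y (a : R) : `]0, 1]%classic a -> 0 <= level_dist x y a.
  by rewrite /= in_itv/=; exact: level_dist_ge0.
have m1 : measurable_fun `](h k), 1] (level_dist (u_ k) v).
  by apply: measurable_funS (measurable_level_dist _ _) => //; exact: measurable_itv.
have m2 := measurable_shift_dist v v (h0 k).
have m3 : measurable_fun `](h k), 1] (fun a => level_dist v (u_ k) (a - h k)).
  apply: measurable_rhausdorff_level; by rewrite h0 lexx.
have e1 : (Lpnorm p `](h k), 1%R] (level_dist (u_ k) v) < (eps / 3)%:E)%E.
  apply: le_lt_trans uk; rewrite (dpE p1).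
  by apply: Lpnorm_subset => //; [exact: measurable_level_dist|exact: ld0].
have e3 : (Lpnorm p `](h k), 1%R] (fun a => level_dist v (u_ k) (a - h k))%R
    < (eps / 3)%:E)%E.
  apply: le_lt_trans uk; rewrite (dp_sym p1) (dpE p1).
  by apply: Lpnorm_shift => //; [exact: measurable_level_dist|exact: ld0].
rewrite [X in (_ < X%:E)%E](_ : _ = eps / 3 + eps / 3 + eps / 3); last by lra.
rewrite !EFinD; apply: le_lt_trans (lteD (lteD e1 vk) e3).
apply: (@le_trans _ _ (Lpnorm p `](h k), 1] (fun a => level_dist (u_ k) v a +
    shift_dist (h k) v v a + level_dist v (u_ k) (a - h k))%R)).
  apply: le_Lpnorm => //; first exact: measurable_shift_dist.
    by apply: measurable_funD m3; exact: measurable_funD.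
  move=> a /h01[a01 ah01].
  have nu := level_nonempty_bounded (u_ k) a01.
  have nv := level_nonempty_bounded v a01.
  have nu' := level_nonempty_bounded (u_ k) ah01.
  have nv' := level_nonempty_bounded v ah01.
  apply/andP; split; first by apply: rhausdorff_ge0; case: nu.
  apply: le_trans (rhausdorff_triangle nu nv' nu') _.
  by rewrite lerD2r; exact: rhausdorff_triangle.
apply: le_trans (LpnormD p1 _ _ m3) _ => //; first exact: measurable_funD.
by rewrite leeD2r// LpnormD.
Unshelve. all: by end_near. Qed.

End compact_consequences.

Theorem theorem5p8 (R : realType) (m : nat) (hm : (1 <= m)%N)
    (p : R) (hp : 1 <= p) (U : set (@FBdp R m p)) :
  compact U <->
  [/\ closed U,
      uniformly_p_mean_bounded U,
      p_mean_equi_left_continuous U &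
      forall u_ : nat -> FBdp m p, (forall n, U (u_ n)) ->
        exists2 r : R, 0 < r &
        exists2 phi : nat -> nat, {homo phi : i j / (i < j)%N} &
          excess p r (u_ (phi n)) @[n --> \oo] --> 0%E].
Proof.
split=> [cU|[clU _ _ exU]].
  split.
  - by apply: compact_closed => //; exact: dp_hausdorff.
  - exact: compact_p_mean_bounded.
  - exact: compact_equi_left_continuous.
  - by move=> u_; exact: compact_ball_excess.
apply: (dp_subseq_compact hp) => u_ Uu.
have [r r0 [phi phiI exc]] := exU u_ Uu.
have exc0 n : (0 <= excess p r (u_ (phi n)))%E.
  by have [_ ->] := excess_Lpnorm (u_ (phi n)) hp r0; exact: Lpnorm_ge0.
have /(cvge0P exc0) exc_lt := exc.
have [w [psi psiI wcvg]] := excess_cvg_subseq hp r0 exc_lt.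
exists w; last first.
  by exists (phi \o psi) => // i j ij /=; exact/phiI/psiI.
apply: clU => B /(nbhs_dpP hp)[e e0 eB].
have [n wn] := filter_ex (wcvg _ e0).
by exists (u_ (phi (psi n))); split=> //; apply: eB; rewrite dp_sym.
Qed.
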